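(* Let $k\in2\mathbb{Z}$, let $m\ge1$ be an integer and let $\lambda\in\mathbb{C}$. Then the antiholomorphic differential operator $\xi_k$ maps $V_k^m(\lambda)$ to $V_{2-k}^m(\overline\lambda)$. If $\lambda\ne0$, this map $\xi_k:V_k^m(\lambda)\to V_{2-k}^m(\overline\lambda)$ is a (conjugate-linear) vector space isomorphism.
   Context: Write $z=x+iy\in\mathbb{H}$ (upper half plane). The weight $k$ hyperbolic Laplacian is $$\Delta_k=y^2\left(\frac{\partial^2}{\partial x^2}+\frac{\partial^2}{\partial y^2}\right)-iky\left(\frac{\partial}{\partial x}+i\frac{\partial}{\partial y}\right).$$ For an integer $m\ge0$ and $\lambda\in\mathbb{C}$, $V_k^m(\lambda)$ is the complex vector space of smooth functions $f:\mathbb{H}\to\mathbb{C}$ such that: $f\left(\frac{az+b}{cz+d}\right)=(cz+d)^kf(z)$ for all $\begin{pmatrix}a&b\\c&d\end{pmatrix}\in\mathrm{PSL}(2,\mathbb{Z})$; $(\Delta_k-\lambda)^mf=0$; and $f(x+iy)=O(y^\alpha)$ for some $\alpha\in\mathbb{R}$ as $y\to\infty$, uniformly in $x$ (moderate growth). The Bruinier–Funke operator is $\xi_kf=2iy^k\,\overline{\frac{\partial f}{\partial\bar z}}$, where $\frac{\partial}{\partial\bar z}=\frac12\left(\frac{\partial}{\partial x}+i\frac{\partial}{\partial y}\right)$. It is conjugate-linear in $f$. *)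

(* Defs.v *)
From Stdlib Require Import Reals Lra ZArith.
From Coquelicot Require Import Coquelicot.

Record upper_half_plane : Type := UHP {
  uhp_val :> C;
  uhp_pos : (0 < Im uhp_val)%R
}.

Notation "'ℍ'" := upper_half_plane.

(* Matrices in SL(2,Z) represent the elements of PSL(2,Z); for even weight k
   the factor (cz+d)^k does not depend on the choice of representative. *)
Record SL2Z : Type := MkSL2Z {
  sl_a : Z; sl_b : Z; sl_c : Z; sl_d : Z;
  sl_det : (sl_a * sl_d - sl_b * sl_c = 1)%Z
}.

Definition automorphy_denom (g : SL2Z) (z : C) : C :=
  (RtoC (IZR (sl_c g)) * z + RtoC (IZR (sl_d g)))%C.

Definition mobius_val (g : SL2Z) (z : C) : C :=
  ((RtoC (IZR (sl_a g)) * z + RtoC (IZR (sl_b g))) / automorphy_denom g z)%C.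

Lemma mobius_pos (g : SL2Z) (z : ℍ) : (0 < Im (mobius_val g z))%R.
Proof.
destruct g as [a b c d Hdet], z as [[x y] Hy].
unfold mobius_val, automorphy_denom, Cdiv, Cinv, Cmult, Cplus, RtoC; simpl in *.
assert (E : (IZR a * IZR d - IZR b * IZR c = 1)%R)
  by (rewrite <- !mult_IZR, <- minus_IZR, Hdet; reflexivity).
revert E; generalize (IZR a) (IZR b) (IZR c) (IZR d); clear a b c d Hdet.
intros a b c d E.
set (u := (c * x - 0 * y + d)%R); set (v := (c * y + 0 * x + 0)%R).
assert (Hn : (0 < u * (u * 1) + v * (v * 1))%R).
{ destruct (Req_dec c 0) as [Hc | Hc].
  - assert (Hd : d <> 0%R) by (intros Hd; subst; lra).
    assert (Hu : u = d) by (unfold u; rewrite Hc; ring).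
    rewrite Hu; pose proof (Rsqr_pos_lt d Hd) as Hp; unfold Rsqr in Hp.
    pose proof (Rle_0_sqr v) as Hq; unfold Rsqr in Hq; lra.
  - assert (Hv : v <> 0%R).
    { unfold v; replace (c * y + 0 * x + 0)%R with (c * y)%R by ring.
      apply Rmult_integral_contrapositive_currified; lra. }
    pose proof (Rsqr_pos_lt v Hv) as Hp; unfold Rsqr in Hp.
    pose proof (Rle_0_sqr u) as Hq; unfold Rsqr in Hq; lra. }
match goal with |- (0 < ?e)%R =>
  replace e with ((a * d - b * c) * y / (u * (u * 1) + v * (v * 1)))%R end.
- rewrite E, Rmult_1_l; apply Rdiv_lt_0_compat; assumption.
- unfold u, v in *; field; lra.
Qed.

Definition mobius (g : SL2Z) (z : ℍ) : ℍ := UHP (mobius_val g z) (mobius_pos g z).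

Definition Cpowz (w : C) (k : Z) : C :=
  match k with
  | Z0 => RtoC 1
  | Zpos p => Cpow w (Pos.to_nat p)
  | Zneg p => (/ Cpow w (Pos.to_nat p))%C
  end.

(* Since the half plane is open, derivatives and continuity at its points do
   not depend on the values of the extension below the real axis. *)
Definition extend (f : ℍ -> C) (w : C) : C :=
  match Rlt_dec 0 (Im w) with
  | left h => f (UHP w h)
  | right _ => RtoC 0
  end.

Definition along_x (f : ℍ -> C) (z : ℍ) : R -> C :=
  fun t => extend f (t, Im z).

Definition along_y (f : ℍ -> C) (z : ℍ) : R -> C :=
  fun t => extend f (Re z, t).

Definition ex_deriveC (g : R -> C) (t : R) : Prop :=
  ex_derive (fun s => Re (g s)) t /\ ex_derive (fun s => Im (g s)) t.

Definition DeriveC (g : R -> C) (t : R) : C :=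
  (Derive (fun s => Re (g s)) t, Derive (fun s => Im (g s)) t).

Definition d_dx (f : ℍ -> C) : ℍ -> C := fun z => DeriveC (along_x f z) (Re z).

Definition d_dy (f : ℍ -> C) : ℍ -> C := fun z => DeriveC (along_y f z) (Im z).

Definition continuousH (f : ℍ -> C) : Prop :=
  forall z : ℍ, continuous (extend f) (uhp_val z).

Fixpoint Ck (n : nat) (f : ℍ -> C) : Prop :=
  match n with
  | O => continuousH f
  | S p =>
      continuousH f /\
      (forall z : ℍ, ex_deriveC (along_x f z) (Re z)) /\
      (forall z : ℍ, ex_deriveC (along_y f z) (Im z)) /\
      Ck p (d_dx f) /\ Ck p (d_dy f)
  end.

Definition smooth (f : ℍ -> C) : Prop := forall n : nat, Ck n f.

Definition d_dzbar (f : ℍ -> C) : ℍ -> C :=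
  fun z => (RtoC (1 / 2) * (d_dx f z + Ci * d_dy f z))%C.

Definition Laplacian (k : Z) (f : ℍ -> C) : ℍ -> C :=
  fun z =>
    let y := RtoC (Im z) in
    (y ^ 2 * (d_dx (d_dx f) z + d_dy (d_dy f) z)
     - Ci * RtoC (IZR k) * y * (d_dx f z + Ci * d_dy f z))%C.

Definition Laplacian_minus (k : Z) (lambda : C) (f : ℍ -> C) : ℍ -> C :=
  fun z => (Laplacian k f z - lambda * f z)%C.

Definition xi (k : Z) (f : ℍ -> C) : ℍ -> C :=
  fun z => (RtoC 2 * Ci * RtoC (powerRZ (Im z) k) * Cconj (d_dzbar f z))%C.

Definition modular (k : Z) (f : ℍ -> C) : Prop :=
  forall (g : SL2Z) (z : ℍ),
    f (mobius g z) = (Cpowz (automorphy_denom g z) k * f z)%C.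

Definition moderate_growth (f : ℍ -> C) : Prop :=
  exists alpha B Y : R,
    forall z : ℍ, (Y <= Im z)%R -> (Cmod (f z) <= B * Rpower (Im z) alpha)%R.

Definition V (k : Z) (m : nat) (lambda : C) (f : ℍ -> C) : Prop :=
  smooth f /\
  modular k f /\
  (forall z : ℍ, Nat.iter m (Laplacian_minus k lambda) f z = RtoC 0) /\
  moderate_growth f.

Definition subspace (S : (ℍ -> C) -> Prop) : Prop :=
  S (fun _ => RtoC 0) /\
  (forall f g, S f -> S g -> S (fun z => (f z + g z)%C)) /\
  (forall (c : C) f, S f -> S (fun z => (c * f z)%C)).

Definition maps_into (S S' : (ℍ -> C) -> Prop) (T : (ℍ -> C) -> (ℍ -> C)) : Prop :=
  forall f, S f -> S' (T f).

Definition conj_linear_on (S : (ℍ -> C) -> Prop) (T : (ℍ -> C) -> (ℍ -> C)) : Prop :=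
  (forall f g, S f -> S g ->
     T (fun z => (f z + g z)%C) = (fun z => (T f z + T g z)%C)) /\
  (forall (c : C) f, S f ->
     T (fun z => (c * f z)%C) = (fun z => (Cconj c * T f z)%C)).

Definition bijective_between (S S' : (ℍ -> C) -> Prop)
    (T : (ℍ -> C) -> (ℍ -> C)) : Prop :=
  maps_into S S' T /\
  (forall f g, S f -> S g -> T f = T g -> f = g) /\
  (forall h, S' h -> exists f, S f /\ T f = h).

Definition conj_linear_iso (S S' : (ℍ -> C) -> Prop)
    (T : (ℍ -> C) -> (ℍ -> C)) : Prop :=
  subspace S /\ subspace S' /\ conj_linear_on S T /\ bijective_between S S' T.

(* Main.v *)
Require Import Defs.
From Stdlib Require Import Reals ZArith Lra Lia FunctionalExtensionality ProofIrrelevance.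
From Coquelicot Require Import Coquelicot.

(** Since [xi_{2-k} o xi_k = Delta_k], the operator [xi_k] intertwines [Delta_k - lambda] with
    [Delta_{2-k} - conj lambda], and for [lambda <> 0] it is bijective because [Delta_k] acts
    invertibly on the generalized eigenspace [V_k^m(lambda)].  Weight [2 - k] of [xi_k f] is the chain
    rule.  The analytic point is that [xi_k] preserves moderate growth, i.e. that the gradient of a
    1-periodic solution [u] of [(Delta_k - lambda)^m u = 0] is bounded near height [y0] by the
    supremum of [|u|] over heights in [[y0 - 1, y0 + 1]], uniformly in [y0 >= 2].  Writing
    [L = (Delta_k - lambda) / y0^2] and using powers of the cutoff [1 - (y - y0)^2] as weights,
    Green's formula over one period yields
      |L u|^2 <= eps |L^2 u|^2 + C |u|^2     and     |grad u|^2 <= |L u|^2 + C |u|^2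
    in weighted L^2; as [L^m u = 0], a downward induction bounds [L u] and [grad u] by [u].  Because
    [d/dx] commutes with [L], the same holds for all [d^j u / dx^j], and a two-dimensional Sobolev
    inequality turns the L^2 bounds into pointwise ones. *)

Local Open Scope R_scope.

(** * Calculus of functions on the half plane *)

(** Elements of [V] are smooth by definition, so only a priori inequalities are needed, and each of
    them is an integrated pointwise polynomial inequality in the moduli of [u], its derivatives and
    the cutoff [e = 1 - (y - y0)^2]. The division by [y0^2] makes all constants independent of [y0]:
    for [y0 >= 2] the ratio [y / y0] stays in [[1/2, 3/2]] on the box. The weights [e^n] replace a
    family of shrinking boxes. Integrating by parts costs one power of [e], and Young's inequality
    splits [e^(q+1) |u| |u_y|] into [e^q |u|^2] and [e^(q+2) |u_y|^2], so each derivative raises the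
    exponent by 2. The obstacle is that testing Green's formula with [u] bounds the gradient only
    through [L u], which need not vanish when [m > 1]. Testing it with [L u] instead bounds [L u] by
    gradients, that of [L u] itself entering with a small coefficient; this is what allows the chain
    of iterates to be closed from its vanishing end. The coefficients depend on [y], so [d/dy] of a
    solution is not a solution: only [d/dx] is iterated, and the second [y]-derivative is read off
    the equation. Three derivatives are needed in the end, hence the weight [e^6]. *)

Lemma uhp_eq (z w : ℍ) : uhp_val z = uhp_val w -> z = w.
Proof.
destruct z as [z hz], w as [w hw]; simpl; intros E; subst.
f_equal; apply proof_irrelevance.
Qed.

Lemma extend_uhp (f : ℍ -> C) (z : ℍ) (w : C) : w = uhp_val z -> extend f w = f z.
Proof.
intros ->; unfold extend; destruct (Rlt_dec 0 (Im z)) as [h | h].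
- f_equal; apply uhp_eq; reflexivity.
- destruct (h (uhp_pos z)).
Qed.

Lemma extend_pos (f : ℍ -> C) (x y : R) (h : 0 < y) :
  extend f (x, y) = f (UHP (x, y) h).
Proof. apply extend_uhp; reflexivity. Qed.

(** Total real functions on the plane are the form in which the library results on limits, partial
    derivatives and integrals apply. *)
Definition re2 (f : ℍ -> C) (x y : R) : R := Re (extend f (x, y)).
Definition im2 (f : ℍ -> C) (x y : R) : R := Im (extend f (x, y)).

Lemma re2_uhp (f : ℍ -> C) (z : ℍ) : re2 f (Re z) (Im z) = Re (f z).
Proof. unfold re2; f_equal; apply extend_uhp; destruct z as [[x y] h]; reflexivity. Qed.

Lemma im2_uhp (f : ℍ -> C) (z : ℍ) : im2 f (Re z) (Im z) = Im (f z).
Proof. unfold im2; f_equal; apply extend_uhp; destruct z as [[x y] h]; reflexivity. Qed.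

Lemma C_ext (a b : C) : Re a = Re b -> Im a = Im b -> a = b.
Proof. destruct a, b; simpl; intros; subst; reflexivity. Qed.

Lemma locally_pos (y : R) : 0 < y -> locally y (fun t => 0 < t).
Proof. apply open_gt. Qed.

(** The square of half-width [y] around a point at height [y] stays above the real axis. *)
Lemma locally_2d_pos (P : R -> R -> Prop) (x y : R) :
  0 < y -> (forall u v, 0 < v -> P u v) -> locally_2d P x y.
Proof.
intros hy hP; exists (mkposreal y hy); simpl; intros u v _ hv; apply hP.
apply Rabs_def2 in hv; lra.
Qed.

Lemma continuousH_2d (f : ℍ -> C) :
  continuousH f <->
  (forall x y, 0 < y -> continuity_2d_pt (re2 f) x y /\ continuity_2d_pt (im2 f) x y).
Proof.
split.
- intros hf x y hy; specialize (hf (UHP (x, y) hy)); simpl in hf.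
  split; apply continuity_2d_pt_filterlim.
  + apply (filterlim_ext (fun w : R * R => Re (extend f w))); [intros [u v]; reflexivity|].
    apply (continuous_comp (extend f) (fun w : C => fst w) (x, y) hf).
    destruct (extend f (x, y)); apply continuous_fst.
  + apply (filterlim_ext (fun w : R * R => Im (extend f w))); [intros [u v]; reflexivity|].
    apply (continuous_comp (extend f) (fun w : C => snd w) (x, y) hf).
    destruct (extend f (x, y)); apply continuous_snd.
- intros hf [[x y] hy]; simpl in *; destruct (hf x y hy) as [h1 h2].
  apply continuity_2d_pt_filterlim in h1; apply continuity_2d_pt_filterlim in h2.
  unfold continuous.
  apply (filterlim_ext (fun w : R * R => (re2 f (fst w) (snd w), im2 f (fst w) (snd w)))).
  { intros [u v]; unfold re2, im2; simpl; destruct (extend f (u, v)); reflexivity. }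
  assert (E : extend f (x, y) = (re2 f x y, im2 f x y))
    by (unfold re2, im2; destruct (extend f (x, y)); reflexivity).
  rewrite E.
  apply (continuous_comp_2 (fun w : R * R => re2 f (fst w) (snd w))
     (fun w : R * R => im2 f (fst w) (snd w)) (fun a b => (a, b)) (x, y) h1 h2).
  simpl; apply continuous_ext with (f := fun z : R * R => z); [intros [a b]; reflexivity|].
  apply continuous_id.
Qed.

Lemma continuousH_of (f : ℍ -> C) (F G : R -> R -> R) :
  (forall z : ℍ, f z = (F (Re z) (Im z), G (Re z) (Im z))) ->
  (forall x y, 0 < y -> continuity_2d_pt F x y /\ continuity_2d_pt G x y) ->
  continuousH f.
Proof.
intros E hFG; apply continuousH_2d; intros x y hy; destruct (hFG x y hy) as [h1 h2].
split; [apply continuity_2d_pt_ext_loc with F | apply continuity_2d_pt_ext_loc with G];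
  trivial; apply locally_2d_pos; trivial; intros u v hv;
  unfold re2, im2; rewrite (extend_pos f u v hv), E; reflexivity.
Qed.

(** [d_dx] rests on the total function [Derive], whose value alone does not imply differentiability.
    This relation carries existence and value together, so it obeys the rules of calculus. *)
Definition is_dx (f : ℍ -> C) (z : ℍ) (l : C) : Prop :=
  is_derive (fun t => re2 f t (Im z)) (Re z) (Re l) /\
  is_derive (fun t => im2 f t (Im z)) (Re z) (Im l).

Definition is_dy (f : ℍ -> C) (z : ℍ) (l : C) : Prop :=
  is_derive (fun t => re2 f (Re z) t) (Im z) (Re l) /\
  is_derive (fun t => im2 f (Re z) t) (Im z) (Im l).

Lemma is_dx_unique f z l : is_dx f z l -> d_dx f z = l.
Proof. intros [h1 h2]; apply C_ext; apply is_derive_unique; assumption. Qed.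

Lemma is_dy_unique f z l : is_dy f z l -> d_dy f z = l.
Proof. intros [h1 h2]; apply C_ext; apply is_derive_unique; assumption. Qed.

Lemma is_dx_ex f z l : is_dx f z l -> ex_deriveC (along_x f z) (Re z).
Proof. intros [h1 h2]; split; [exists (Re l) | exists (Im l)]; assumption. Qed.

Lemma is_dy_ex f z l : is_dy f z l -> ex_deriveC (along_y f z) (Im z).
Proof. intros [h1 h2]; split; [exists (Re l) | exists (Im l)]; assumption. Qed.

Lemma Ck_dx n f z : Ck (S n) f -> is_dx f z (d_dx f z).
Proof. intros (_ & h & _); destruct (h z) as [h1 h2]; split; apply Derive_correct; assumption. Qed.

Lemma Ck_dy n f z : Ck (S n) f -> is_dy f z (d_dy f z).
Proof. intros (_ & _ & h & _); destruct (h z) as [h1 h2]; split; apply Derive_correct; assumption. Qed.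

Lemma Ck_cont n f : Ck n f -> continuousH f.
Proof. destruct n; [trivial | intros [h _]; exact h]. Qed.

Lemma Ck_pred n f : Ck (S n) f -> Ck n f.
Proof.
revert f; induction n as [|n IH]; intros f h; [exact (proj1 h)|].
destruct h as (h0 & h1 & h2 & h3 & h4); exact (conj h0 (conj h1 (conj h2 (conj (IH _ h3) (IH _ h4))))).
Qed.

(** [Ck] speaks of [d_dx f] and [d_dy f] as functions. Extensionality replaces them by closed
    formulas, to which an induction hypothesis on sums and products applies. *)
Lemma Ck_intro n f fx fy :
  continuousH f -> (forall z, is_dx f z (fx z)) -> (forall z, is_dy f z (fy z)) ->
  Ck n fx -> Ck n fy -> Ck (S n) f.
Proof.
intros h0 hx hy h1 h2; simpl; split; [exact h0|].
split; [intros z; eapply is_dx_ex, hx|]; split; [intros z; eapply is_dy_ex, hy|].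
replace (d_dx f) with fx; [replace (d_dy f) with fy; [split; trivial|]|];
  extensionality z; symmetry; [apply is_dy_unique | apply is_dx_unique]; auto.
Qed.

(* The extension by zero of a function given by an expression agrees with the
   expression only above the real axis, so derivatives in y are compared locally. *)
Lemma is_dx_of (f : ℍ -> C) (z : ℍ) (F G : R -> R -> R) l :
  (forall x y h, f (UHP (x, y) h) = (F x y, G x y)) ->
  is_derive (fun t => F t (Im z)) (Re z) (Re l) ->
  is_derive (fun t => G t (Im z)) (Re z) (Im l) -> is_dx f z l.
Proof.
intros E h1 h2; split; [eapply is_derive_ext; [|exact h1] | eapply is_derive_ext; [|exact h2]];
  intros t; unfold re2, im2; rewrite (extend_pos f t (Im z) (uhp_pos z)), E; reflexivity.
Qed.

Lemma is_dy_of (f : ℍ -> C) (z : ℍ) (F G : R -> R -> R) l :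
  (forall x y h, f (UHP (x, y) h) = (F x y, G x y)) ->
  is_derive (fun t => F (Re z) t) (Im z) (Re l) ->
  is_derive (fun t => G (Re z) t) (Im z) (Im l) -> is_dy f z l.
Proof.
intros E h1 h2; split; [eapply is_derive_ext_loc; [|exact h1] | eapply is_derive_ext_loc; [|exact h2]];
  generalize (locally_pos (Im z) (uhp_pos z)); apply filter_imp;
  intros t ht; unfold re2, im2; rewrite (extend_pos f (Re z) t ht), E; reflexivity.
Qed.

Lemma uhp_2d (f : ℍ -> C) (x y : R) (h : 0 < y) : f (UHP (x, y) h) = (re2 f x y, im2 f x y).
Proof. unfold re2, im2; rewrite (extend_pos f x y h); destruct (f _); reflexivity. Qed.

Lemma uhp_2d' (f : ℍ -> C) (z : ℍ) : f z = (re2 f (Re z) (Im z), im2 f (Re z) (Im z)).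
Proof. rewrite re2_uhp, im2_uhp; destruct (f z); reflexivity. Qed.

Lemma is_dx_plus f g z l m : is_dx f z l -> is_dx g z m ->
  is_dx (fun z => (f z + g z)%C) z (l + m)%C.
Proof.
intros [f1 f2] [g1 g2].
apply (is_dx_of _ z (fun x y => re2 f x y + re2 g x y) (fun x y => im2 f x y + im2 g x y)).
- intros x y h; rewrite !uhp_2d; reflexivity.
- exact (is_derive_plus _ _ _ _ _ f1 g1).
- exact (is_derive_plus _ _ _ _ _ f2 g2).
Qed.

Lemma is_dy_plus f g z l m : is_dy f z l -> is_dy g z m ->
  is_dy (fun z => (f z + g z)%C) z (l + m)%C.
Proof.
intros [f1 f2] [g1 g2].
apply (is_dy_of _ z (fun x y => re2 f x y + re2 g x y) (fun x y => im2 f x y + im2 g x y)).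
- intros x y h; rewrite !uhp_2d; reflexivity.
- exact (is_derive_plus _ _ _ _ _ f1 g1).
- exact (is_derive_plus _ _ _ _ _ f2 g2).
Qed.


Lemma is_derive_mult_minus (f g p q : R -> R) (x a b c d l : R) :
  is_derive f x a -> is_derive g x b -> is_derive p x c -> is_derive q x d ->
  l = a * g x + f x * b - (c * q x + p x * d) ->
  is_derive (fun t => f t * g t - p t * q t) x l.
Proof.
intros hf hg hp hq ->.
exact (is_derive_minus _ _ _ _ _ (is_derive_mult f g x a b hf hg Rmult_comm)
         (is_derive_mult p q x c d hp hq Rmult_comm)).
Qed.

Lemma is_derive_mult_plus (f g p q : R -> R) (x a b c d l : R) :
  is_derive f x a -> is_derive g x b -> is_derive p x c -> is_derive q x d ->
  l = a * g x + f x * b + (c * q x + p x * d) ->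
  is_derive (fun t => f t * g t + p t * q t) x l.
Proof.
intros hf hg hp hq ->.
exact (is_derive_plus _ _ _ _ _ (is_derive_mult f g x a b hf hg Rmult_comm)
         (is_derive_mult p q x c d hp hq Rmult_comm)).
Qed.

Lemma is_dx_mult f g z l m : is_dx f z l -> is_dx g z m ->
  is_dx (fun z => (f z * g z)%C) z (l * g z + f z * m)%C.
Proof.
intros [f1 f2] [g1 g2].
apply (is_dx_of _ z (fun x y => re2 f x y * re2 g x y - im2 f x y * im2 g x y)
         (fun x y => re2 f x y * im2 g x y + im2 f x y * re2 g x y)).
- intros x y h; rewrite !uhp_2d; reflexivity.
- eapply is_derive_mult_minus; try eassumption; rewrite (uhp_2d' f), (uhp_2d' g); unfold Re, Im; simpl; ring.
- eapply is_derive_mult_plus; try eassumption; rewrite (uhp_2d' f), (uhp_2d' g); unfold Re, Im; simpl; ring.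
Qed.

Lemma is_dy_mult f g z l m : is_dy f z l -> is_dy g z m ->
  is_dy (fun z => (f z * g z)%C) z (l * g z + f z * m)%C.
Proof.
intros [f1 f2] [g1 g2].
apply (is_dy_of _ z (fun x y => re2 f x y * re2 g x y - im2 f x y * im2 g x y)
         (fun x y => re2 f x y * im2 g x y + im2 f x y * re2 g x y)).
- intros x y h; rewrite !uhp_2d; reflexivity.
- eapply is_derive_mult_minus; try eassumption; rewrite (uhp_2d' f), (uhp_2d' g); unfold Re, Im; simpl; ring.
- eapply is_derive_mult_plus; try eassumption; rewrite (uhp_2d' f), (uhp_2d' g); unfold Re, Im; simpl; ring.
Qed.

Lemma is_dx_conj f z l : is_dx f z l -> is_dx (fun z => Cconj (f z)) z (Cconj l).
Proof.
intros [f1 f2]; apply (is_dx_of _ z (re2 f) (fun x y => - im2 f x y)).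
- intros x y h; rewrite !uhp_2d; reflexivity.
- exact f1.
- exact (is_derive_opp _ _ _ f2).
Qed.

Lemma is_dy_conj f z l : is_dy f z l -> is_dy (fun z => Cconj (f z)) z (Cconj l).
Proof.
intros [f1 f2]; apply (is_dy_of _ z (re2 f) (fun x y => - im2 f x y)).
- intros x y h; rewrite !uhp_2d; reflexivity.
- exact f1.
- exact (is_derive_opp _ _ _ f2).
Qed.

Lemma is_dx_const c z : is_dx (fun _ => c) z (RtoC 0).
Proof.
apply (is_dx_of _ z (fun _ _ => Re c) (fun _ _ => Im c));
  [intros; destruct c; reflexivity | |]; apply @is_derive_const.
Qed.

Lemma is_dy_const c z : is_dy (fun _ => c) z (RtoC 0).
Proof.
apply (is_dy_of _ z (fun _ _ => Re c) (fun _ _ => Im c));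
  [intros; destruct c; reflexivity | |]; apply @is_derive_const.
Qed.

Lemma continuousH_plus f g : continuousH f -> continuousH g ->
  continuousH (fun z => (f z + g z)%C).
Proof.
intros hf hg; pose proof (proj1 (continuousH_2d f) hf) as hf'; pose proof (proj1 (continuousH_2d g) hg) as hg'.
apply (continuousH_of _ (fun x y => re2 f x y + re2 g x y) (fun x y => im2 f x y + im2 g x y)).
- intros z; rewrite (uhp_2d' f), (uhp_2d' g); reflexivity.
- intros x y hy; destruct (hf' x y hy), (hg' x y hy).
  split; apply continuity_2d_pt_plus; assumption.
Qed.

Lemma continuousH_mult f g : continuousH f -> continuousH g ->
  continuousH (fun z => (f z * g z)%C).
Proof.
intros hf hg; pose proof (proj1 (continuousH_2d f) hf) as hf'; pose proof (proj1 (continuousH_2d g) hg) as hg'.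
apply (continuousH_of _ (fun x y => re2 f x y * re2 g x y - im2 f x y * im2 g x y)
         (fun x y => re2 f x y * im2 g x y + im2 f x y * re2 g x y)).
- intros z; rewrite (uhp_2d' f), (uhp_2d' g); reflexivity.
- intros x y hy; destruct (hf' x y hy), (hg' x y hy).
  split; [apply continuity_2d_pt_minus | apply continuity_2d_pt_plus];
    apply continuity_2d_pt_mult; assumption.
Qed.

Lemma continuousH_conj f : continuousH f -> continuousH (fun z => Cconj (f z)).
Proof.
intros hf; pose proof (proj1 (continuousH_2d f) hf) as hf'.
apply (continuousH_of _ (re2 f) (fun x y => - im2 f x y)).
- intros z; rewrite (uhp_2d' f); reflexivity.
- intros x y hy; destruct (hf' x y hy); split; [|apply continuity_2d_pt_opp]; assumption.
Qed.

Lemma continuousH_const c : continuousH (fun _ => c).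
Proof.
apply (continuousH_of _ (fun _ _ => Re c) (fun _ _ => Im c)); [intros; destruct c; reflexivity|].
intros; split; apply continuity_2d_pt_const.
Qed.

Lemma Ck_const n c : Ck n (fun _ => c).
Proof.
revert c; induction n as [|n IH]; intros c; [apply continuousH_const|].
apply (Ck_intro n _ (fun _ => RtoC 0) (fun _ => RtoC 0));
  auto using continuousH_const, is_dx_const, is_dy_const.
Qed.

Lemma Ck_plus n f g : Ck n f -> Ck n g -> Ck n (fun z => (f z + g z)%C).
Proof.
revert f g; induction n as [|n IH]; intros f g hf hg; [apply continuousH_plus; trivial|].
apply (Ck_intro n _ (fun z => (d_dx f z + d_dx g z)%C) (fun z => (d_dy f z + d_dy g z)%C)).
- apply continuousH_plus; eapply Ck_cont; eassumption.
- intros z; apply is_dx_plus; eapply Ck_dx; eassumption.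
- intros z; apply is_dy_plus; eapply Ck_dy; eassumption.
- apply IH; [apply hf | apply hg].
- apply IH; [apply hf | apply hg].
Qed.

Lemma Ck_mult n f g : Ck n f -> Ck n g -> Ck n (fun z => (f z * g z)%C).
Proof.
revert f g; induction n as [|n IH]; intros f g hf hg; [apply continuousH_mult; trivial|].
apply (Ck_intro n _ (fun z => (d_dx f z * g z + f z * d_dx g z)%C)
  (fun z => (d_dy f z * g z + f z * d_dy g z)%C)).
- apply continuousH_mult; eapply Ck_cont; eassumption.
- intros z; apply is_dx_mult; eapply Ck_dx; eassumption.
- intros z; apply is_dy_mult; eapply Ck_dy; eassumption.
- apply Ck_plus; apply IH; try exact (Ck_pred _ _ hf); try exact (Ck_pred _ _ hg);
    [apply hf | apply hg].
- apply Ck_plus; apply IH; try exact (Ck_pred _ _ hf); try exact (Ck_pred _ _ hg);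
    [apply hf | apply hg].
Qed.

Lemma Ck_conj n f : Ck n f -> Ck n (fun z => Cconj (f z)).
Proof.
revert f; induction n as [|n IH]; intros f hf; [apply continuousH_conj; trivial|].
apply (Ck_intro n _ (fun z => Cconj (d_dx f z)) (fun z => Cconj (d_dy f z))).
- apply continuousH_conj; eapply Ck_cont; eassumption.
- intros z; apply is_dx_conj; eapply Ck_dx; eassumption.
- intros z; apply is_dy_conj; eapply Ck_dy; eassumption.
- apply IH, hf.
- apply IH, hf.
Qed.

(** * Explicit smooth functions: coordinates, powers of [y], cutoffs *)

Definition xcoord : ℍ -> C := fun z => RtoC (Re z).
Definition ypow (k : Z) : ℍ -> C := fun z => RtoC (powerRZ (Im z) k).

Lemma continuousH_xcoord : continuousH xcoord.
Proof.
apply (continuousH_of _ (fun x _ => x) (fun _ _ => 0)); [reflexivity|].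
intros; split; [apply continuity_2d_pt_id1 | apply continuity_2d_pt_const].
Qed.

Lemma is_dx_xcoord z : is_dx xcoord z (RtoC 1).
Proof.
apply (is_dx_of _ z (fun x _ => x) (fun _ _ => 0)); [reflexivity| |];
 [apply (is_derive_id (K := R_AbsRing)) | apply @is_derive_const].
Qed.

Lemma is_dy_xcoord z : is_dy xcoord z (RtoC 0).
Proof.
apply (is_dy_of _ z (fun x _ => x) (fun _ _ => 0)); [reflexivity| |];
 apply @is_derive_const.
Qed.

Lemma smooth_xcoord : smooth xcoord.
Proof.
intros [|n]; [exact continuousH_xcoord|].
apply (Ck_intro n _ _ _ continuousH_xcoord is_dx_xcoord is_dy_xcoord); apply Ck_const.
Qed.

Lemma is_derive_powerRZ (k : Z) (y : R) : 0 < y ->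
  is_derive (fun t => powerRZ t k) y (IZR k * powerRZ y (k - 1)).
Proof.
intros hy.
assert (Hpow : forall n, is_derive (fun t => t ^ n) y (INR n * y ^ pred n)).
{ intros n; replace (INR n * y ^ pred n) with (INR n * 1 * y ^ pred n) by ring.
  apply (is_derive_pow (fun t => t) n y 1), (is_derive_id (K := R_AbsRing)). }
destruct k as [|p|p].
- rewrite Rmult_0_l; exact (is_derive_const (1 : R) y).
- replace (IZR (Z.pos p) * powerRZ y (Z.pos p - 1))
    with (INR (Pos.to_nat p) * y ^ pred (Pos.to_nat p)); [apply Hpow|].
  rewrite INR_IZR_INZ, positive_nat_Z; f_equal.
  rewrite pow_powerRZ; f_equal; lia.
- assert (Hy : y ^ Pos.to_nat p <> 0) by (apply pow_nonzero; lra).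
  evar_last; [apply is_derive_inv; [apply Hpow | exact Hy]|].
  rewrite INR_IZR_INZ, positive_nat_Z.
  replace (Z.neg p - 1)%Z with (- Z.of_nat (S (Pos.to_nat p)))%Z by lia.
  rewrite powerRZ_neg', <- pow_powerRZ.
  change (IZR (Z.neg p)) with (- IZR (Z.pos p)).
  destruct (Pos2Nat.is_succ p) as [n Hn]; rewrite Hn in *; simpl in *; rewrite ?SuccNat2Pos.id_succ in *; simpl in *.
  field; split; [|lra]; intros h; apply Hy; rewrite h; ring.
Qed.

Lemma continuousH_ypow k : continuousH (ypow k).
Proof.
apply (continuousH_of _ (fun _ y => powerRZ y k) (fun _ _ => 0)); [reflexivity|].
intros x y hy; split; [|apply continuity_2d_pt_const].
apply (continuity_1d_2d_pt_comp (fun t => powerRZ t k) (fun _ y => y)).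
- apply continuity_pt_filterlim, (ex_derive_continuous (fun t => powerRZ t k) y).
  eexists; apply is_derive_powerRZ, hy.
- apply continuity_2d_pt_id2.
Qed.

Lemma is_dx_ypow k z : is_dx (ypow k) z (RtoC 0).
Proof.
apply (is_dx_of _ z (fun _ y => powerRZ y k) (fun _ _ => 0)); [reflexivity| |];
 apply @is_derive_const.
Qed.

Lemma is_dy_ypow k z : is_dy (ypow k) z (RtoC (IZR k) * ypow (k - 1) z)%C.
Proof.
apply (is_dy_of _ z (fun _ y => powerRZ y k) (fun _ _ => 0)); [reflexivity| |].
- evar_last; [apply is_derive_powerRZ, uhp_pos | simpl; ring].
- evar_last; [apply @is_derive_const | simpl; unfold zero; simpl; ring].
Qed.

Lemma smooth_ypow k : smooth (ypow k).
Proof.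
intros n; revert k; induction n as [|n IH]; intros k; [apply continuousH_ypow|].
apply (Ck_intro n _ _ _ (continuousH_ypow k) (is_dx_ypow k) (is_dy_ypow k)).
- apply Ck_const.
- apply Ck_mult; [apply Ck_const | apply IH].
Qed.

(** Being polynomial in [y], it has an exact derivative of the same kind. It acts as a cutoff only
    for [|y - y0| <= 1], the range over which it is integrated; there its base lies in [[0, 1]] and
    vanishes at both ends. *)
Definition cutoff (y0 : R) (n : nat) : ℍ -> C :=
  fun z => RtoC ((1 - (Im z - y0) ^ 2) ^ n).

Lemma is_dx_cutoff y0 n z : is_dx (cutoff y0 n) z (RtoC 0).
Proof.
apply (is_dx_of _ z (fun _ y => (1 - (y - y0) ^ 2) ^ n) (fun _ _ => 0)); [reflexivity| |];
 apply @is_derive_const.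
Qed.

(** The truncated [pred] is harmless at [n = 0], where the factor [INR n] vanishes. Here [ypow 1]
    serves as the coordinate [y]. *)
Lemma is_dy_cutoff y0 n z : is_dy (cutoff y0 n) z
  (RtoC (INR n) * cutoff y0 (pred n) z * (RtoC (-2) * (ypow 1 z - RtoC y0)))%C.
Proof.
apply (is_dy_of _ z (fun _ y => (1 - (y - y0) ^ 2) ^ n) (fun _ _ => 0)); [reflexivity| |].
- evar_last; [apply (is_derive_pow (fun t => 1 - (t - y0) ^ 2)); auto_derive; trivial|].
  unfold Re, cutoff, ypow; simpl; ring.
- evar_last; [apply @is_derive_const | unfold Im, zero; simpl; ring].
Qed.

Lemma smooth_cutoff y0 n : smooth (cutoff y0 n).
Proof.
intros m; revert n; induction m as [|m IH]; intros n.
- apply (continuousH_of _ (fun _ y => (1 - (y - y0) ^ 2) ^ n) (fun _ _ => 0)); [reflexivity|].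
  intros x y hy; split; [|apply continuity_2d_pt_const].
  apply (continuity_1d_2d_pt_comp (fun t => (1 - (t - y0) ^ 2) ^ n) (fun _ y => y)).
  + apply continuity_pt_filterlim, (ex_derive_continuous (fun t => (1 - (t - y0) ^ 2) ^ n) y).
    auto_derive; trivial.
  + apply continuity_2d_pt_id2.
- apply (Ck_intro m _ _ _ (Ck_cont m _ (IH n)) (is_dx_cutoff y0 n) (is_dy_cutoff y0 n)).
  + apply Ck_const.
  + repeat apply Ck_mult; try apply Ck_const; [apply IH|].
    apply Ck_plus; [apply smooth_ypow|].
    replace (fun _ : ℍ => (- RtoC y0)%C) with (fun _ : ℍ => RtoC (- y0)); [apply Ck_const|].
    extensionality w; apply RtoC_opp.
Qed.

Arguments d_dx : simpl never.
Arguments d_dy : simpl never.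

Lemma smooth_cont f : smooth f -> continuousH f.
Proof. intros h; exact (h 0%nat). Qed.

Lemma smooth_dx f : smooth f -> smooth (d_dx f).
Proof. intros h n; apply (h (S n)). Qed.

Lemma smooth_dy f : smooth f -> smooth (d_dy f).
Proof. intros h n; apply (h (S n)). Qed.

Lemma smooth_plus f g : smooth f -> smooth g -> smooth (fun z => (f z + g z)%C).
Proof. intros hf hg n; apply Ck_plus; auto. Qed.

Lemma smooth_mult f g : smooth f -> smooth g -> smooth (fun z => (f z * g z)%C).
Proof. intros hf hg n; apply Ck_mult; auto. Qed.

Lemma smooth_conj f : smooth f -> smooth (fun z => Cconj (f z)).
Proof. intros hf n; apply Ck_conj; auto. Qed.

Lemma smooth_const c : smooth (fun _ => c).
Proof. intros n; apply Ck_const. Qed.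

Lemma smooth_opp f : smooth f -> smooth (fun z => (- f z)%C).
Proof.
intros hf; replace (fun z => (- f z)%C) with (fun z => (RtoC (-1) * f z)%C)
  by (extensionality z; apply C_ext; simpl; ring).
apply smooth_mult; auto using smooth_const.
Qed.

Lemma smooth_minus f g : smooth f -> smooth g -> smooth (fun z => (f z - g z)%C).
Proof. intros hf hg; apply smooth_plus; auto using smooth_opp. Qed.

Lemma is_dx_smooth f z : smooth f -> is_dx f z (d_dx f z).
Proof. intros h; exact (Ck_dx 0 f z (h 1%nat)). Qed.

Lemma is_dy_smooth f z : smooth f -> is_dy f z (d_dy f z).
Proof. intros h; exact (Ck_dy 0 f z (h 1%nat)). Qed.

Lemma is_dx_opp f z l : is_dx f z l -> is_dx (fun z => (- f z)%C) z (- l)%C.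
Proof.
intros [f1 f2]; apply (is_dx_of _ z (fun x y => - re2 f x y) (fun x y => - im2 f x y)).
- intros x y h; rewrite !uhp_2d; reflexivity.
- exact (is_derive_opp _ _ _ f1).
- exact (is_derive_opp _ _ _ f2).
Qed.

Lemma is_dy_opp f z l : is_dy f z l -> is_dy (fun z => (- f z)%C) z (- l)%C.
Proof.
intros [f1 f2]; apply (is_dy_of _ z (fun x y => - re2 f x y) (fun x y => - im2 f x y)).
- intros x y h; rewrite !uhp_2d; reflexivity.
- exact (is_derive_opp _ _ _ f1).
- exact (is_derive_opp _ _ _ f2).
Qed.

Lemma is_dx_minus f g z l m : is_dx f z l -> is_dx g z m ->
  is_dx (fun z => (f z - g z)%C) z (l - m)%C.
Proof. intros hf hg; apply is_dx_plus; auto using is_dx_opp. Qed.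

Lemma is_dy_minus f g z l m : is_dy f z l -> is_dy g z m ->
  is_dy (fun z => (f z - g z)%C) z (l - m)%C.
Proof. intros hf hg; apply is_dy_plus; auto using is_dy_opp. Qed.



Ltac smooth := repeat first [assumption | simple apply smooth_const | simple apply smooth_ypow
  | simple apply smooth_xcoord | simple apply smooth_cutoff | simple apply smooth_cutoff | simple apply smooth_dx | simple apply smooth_dy
  | simple apply smooth_minus | simple apply smooth_plus | simple apply smooth_mult
  | simple apply smooth_conj | simple apply smooth_opp].

Ltac is_dx_tac := repeat first [simple apply is_dx_const | simple apply is_dx_ypow
  | simple apply is_dx_xcoord | simple apply is_dx_cutoff | simple eapply is_dx_minus | simple eapply is_dx_plus
  | simple eapply is_dx_mult | simple eapply is_dx_conj | simple eapply is_dx_opp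
  | apply is_dx_smooth; solve [smooth]].

Ltac is_dy_tac := repeat first [simple apply is_dy_const | simple apply is_dy_ypow
  | simple apply is_dy_xcoord | simple apply is_dy_cutoff | simple eapply is_dy_minus | simple eapply is_dy_plus
  | simple eapply is_dy_mult | simple eapply is_dy_conj | simple eapply is_dy_opp
  | apply is_dy_smooth; solve [smooth]].

Lemma d_dx_dy f : smooth f -> d_dx (d_dy f) = d_dy (d_dx f).
Proof.
intros hf; extensionality z; destruct z as [[x y] hy].
assert (hx : forall u v (h : 0 < v), is_dx f (UHP (u, v) h) (d_dx f (UHP (u, v) h)))
  by (intros; apply is_dx_smooth; smooth).
assert (hy' : forall u v (h : 0 < v), is_dy f (UHP (u, v) h) (d_dy f (UHP (u, v) h)))
  by (intros; apply is_dy_smooth; smooth).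
assert (hyx : forall u v (h : 0 < v), is_dy (d_dx f) (UHP (u, v) h) (d_dy (d_dx f) (UHP (u, v) h)))
  by (intros; apply is_dy_smooth; smooth).
assert (hxy : forall u v (h : 0 < v), is_dx (d_dy f) (UHP (u, v) h) (d_dx (d_dy f) (UHP (u, v) h)))
  by (intros; apply is_dx_smooth; smooth).
assert (cxy := proj1 (continuousH_2d _) (smooth_cont _ (smooth_dx _ (smooth_dy _ hf)))).
assert (cyx := proj1 (continuousH_2d _) (smooth_cont _ (smooth_dy _ (smooth_dx _ hf)))).
unfold is_dx, is_dy in *; simpl in *.
(* Schwarz's theorem is real-valued. It is proved once for an abstract component [F] with projection
   [p], then used for the real and the imaginary part. *)
assert (S : forall (F : (ℍ -> C) -> R -> R -> R) (p : C -> R),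
  (forall g u v (h : 0 < v), F g u v = p (g (UHP (u, v) h))) ->
  (forall u v (h : 0 < v), is_derive (fun t => F f t v) u (p (d_dx f (UHP (u, v) h)))) ->
  (forall u v (h : 0 < v), is_derive (fun t => F f u t) v (p (d_dy f (UHP (u, v) h)))) ->
  (forall u v (h : 0 < v),
    is_derive (fun t => F (d_dx f) u t) v (p (d_dy (d_dx f) (UHP (u, v) h)))) ->
  (forall u v (h : 0 < v),
    is_derive (fun t => F (d_dy f) t v) u (p (d_dx (d_dy f) (UHP (u, v) h)))) ->
  (forall u v, 0 < v -> continuity_2d_pt (F (d_dx (d_dy f))) u v) ->
  (forall u v, 0 < v -> continuity_2d_pt (F (d_dy (d_dx f))) u v) ->
  p (d_dx (d_dy f) (UHP (x, y) hy)) = p (d_dy (d_dx f) (UHP (x, y) hy))).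
{ clear; intros F p hp fx fy fyx fxy c1 c2.
  assert (fyx' : forall u v (h : 0 < v),
      is_derive (fun t => Derive (fun s => F f s t) u) v (p (d_dy (d_dx f) (UHP (u, v) h)))).
  { intros u v h; apply (is_derive_ext_loc (fun t => F (d_dx f) u t)); [|apply fyx].
    generalize (locally_pos v h); apply filter_imp; intros t ht.
    rewrite (hp _ u t ht); symmetry; apply is_derive_unique, fx. }
  assert (fxy' : forall u v (h : 0 < v),
      is_derive (fun t => Derive (fun s => F f t s) v) u (p (d_dx (d_dy f) (UHP (u, v) h)))).
  { intros u v h; apply (is_derive_ext (fun t => F (d_dy f) t v)); [|apply fxy].
  intros t; rewrite (hp _ t v h); symmetry; apply is_derive_unique, fy. }
  assert (E1 := is_derive_unique _ _ _ (fxy' x y hy)).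
  assert (E2 := is_derive_unique _ _ _ (fyx' x y hy)); cbv beta in E1, E2.
  refine (eq_trans (eq_sym E1) (eq_trans _ E2)); clear E1 E2.
  apply Schwarz.
  - apply locally_2d_pos; trivial; intros u v h; repeat split; eexists;
      [apply (fx u v h) | apply (fy u v h) | apply (fxy' u v h) | apply (fyx' u v h)].
  - apply continuity_2d_pt_ext_loc with (F (d_dx (d_dy f))); [|apply c1; trivial].
    apply locally_2d_pos; trivial; intros u v h; rewrite (hp _ u v h).
    symmetry; apply is_derive_unique, fxy'.
  - apply continuity_2d_pt_ext_loc with (F (d_dy (d_dx f))); [|apply c2; trivial].
    apply locally_2d_pos; trivial; intros u v h; rewrite (hp _ u v h).
    symmetry; apply is_derive_unique, fyx'. }
apply C_ext.
- apply (S re2 Re (fun g u v h => f_equal Re (extend_pos g u v h))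
    (fun u v h => proj1 (hx u v h)) (fun u v h => proj1 (hy' u v h))
    (fun u v h => proj1 (hyx u v h)) (fun u v h => proj1 (hxy u v h))
    (fun u v h => proj1 (cxy u v h)) (fun u v h => proj1 (cyx u v h))).
- apply (S im2 Im (fun g u v h => f_equal Im (extend_pos g u v h))
    (fun u v h => proj2 (hx u v h)) (fun u v h => proj2 (hy' u v h))
    (fun u v h => proj2 (hyx u v h)) (fun u v h => proj2 (hxy u v h))
    (fun u v h => proj2 (cxy u v h)) (fun u v h => proj2 (cyx u v h))).
Qed.

Lemma d_dx_plus f g : smooth f -> smooth g ->
  d_dx (fun z => (f z + g z)%C) = (fun z => (d_dx f z + d_dx g z)%C).
Proof. intros; extensionality z; apply is_dx_unique; is_dx_tac. Qed.

Lemma d_dy_plus f g : smooth f -> smooth g ->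
  d_dy (fun z => (f z + g z)%C) = (fun z => (d_dy f z + d_dy g z)%C).
Proof. intros; extensionality z; apply is_dy_unique; is_dy_tac. Qed.

Lemma d_dx_scal c f : smooth f -> d_dx (fun z => (c * f z)%C) = (fun z => (c * d_dx f z)%C).
Proof.
intros; extensionality z; apply is_dx_unique.
replace (c * d_dx f z)%C with (RtoC 0 * f z + c * d_dx f z)%C by ring; is_dx_tac.
Qed.

Lemma d_dy_scal c f : smooth f -> d_dy (fun z => (c * f z)%C) = (fun z => (c * d_dy f z)%C).
Proof.
intros; extensionality z; apply is_dy_unique.
replace (c * d_dy f z)%C with (RtoC 0 * f z + c * d_dy f z)%C by ring; is_dy_tac.
Qed.

(** * The Laplacian and [xi] on smooth functions *)

Lemma Laplacian_eq k f : Laplacian k f = fun z =>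
  (ypow 2 z * (d_dx (d_dx f) z + d_dy (d_dy f) z)
   - Ci * RtoC (IZR k) * ypow 1 z * (d_dx f z + Ci * d_dy f z))%C.
Proof.
extensionality z; unfold Laplacian, ypow; simpl.
rewrite Rmult_1_r, RtoC_mult; ring.
Qed.

Lemma smooth_Laplacian k f : smooth f -> smooth (Laplacian k f).
Proof. intros; rewrite Laplacian_eq; smooth. Qed.

Lemma smooth_Laplacian_minus k l f : smooth f -> smooth (Laplacian_minus k l f).
Proof.
intros; unfold Laplacian_minus; apply smooth_minus; [apply smooth_Laplacian|]; smooth.
Qed.

Lemma smooth_iter k l m f : smooth f -> smooth (Nat.iter m (Laplacian_minus k l) f).
Proof. intros hf; induction m; simpl; trivial; apply smooth_Laplacian_minus; trivial. Qed.

Lemma Laplacian_plus k f g : smooth f -> smooth g ->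
  Laplacian k (fun z => (f z + g z)%C) = fun z => (Laplacian k f z + Laplacian k g z)%C.
Proof.
intros hf hg; extensionality z; unfold Laplacian.
rewrite !d_dx_plus, !d_dy_plus by smooth; ring.
Qed.

Lemma Laplacian_scal k c f : smooth f ->
  Laplacian k (fun z => (c * f z)%C) = fun z => (c * Laplacian k f z)%C.
Proof.
intros hf; extensionality z; unfold Laplacian.
rewrite !d_dx_scal, !d_dy_scal by smooth; ring.
Qed.

Lemma Laplacian_minus_plus k l f g : smooth f -> smooth g ->
  Laplacian_minus k l (fun z => (f z + g z)%C) =
  fun z => (Laplacian_minus k l f z + Laplacian_minus k l g z)%C.
Proof.
intros hf hg; extensionality z; unfold Laplacian_minus; rewrite Laplacian_plus by trivial; ring.
Qed.

Lemma Laplacian_minus_scal k l c f : smooth f ->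
  Laplacian_minus k l (fun z => (c * f z)%C) = fun z => (c * Laplacian_minus k l f z)%C.
Proof.
intros hf; extensionality z; unfold Laplacian_minus; rewrite Laplacian_scal by trivial; ring.
Qed.

Lemma iter_plus k l m f g : smooth f -> smooth g ->
  Nat.iter m (Laplacian_minus k l) (fun z => (f z + g z)%C) =
  fun z => (Nat.iter m (Laplacian_minus k l) f z + Nat.iter m (Laplacian_minus k l) g z)%C.
Proof.
intros hf hg; induction m; simpl; trivial; rewrite IHm; apply Laplacian_minus_plus;
  apply smooth_iter; trivial.
Qed.

Lemma iter_scal k l m c f : smooth f ->
  Nat.iter m (Laplacian_minus k l) (fun z => (c * f z)%C) =
  fun z => (c * Nat.iter m (Laplacian_minus k l) f z)%C.
Proof.
intros hf; induction m; simpl; trivial; rewrite IHm; apply Laplacian_minus_scal;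
  apply smooth_iter; trivial.
Qed.

(** The coefficients of the Laplacian depend on [y] only, so the operator is invariant under
    horizontal translation; the rest is symmetry of mixed partials. *)
Lemma Laplacian_minus_dx k l f : smooth f ->
  Laplacian_minus k l (d_dx f) = d_dx (Laplacian_minus k l f).
Proof.
intros hf; extensionality z; symmetry; apply is_dx_unique.
unfold Laplacian_minus; rewrite Laplacian_eq, (Laplacian_eq k (d_dx f)).
evar_last; [is_dx_tac|].
rewrite <- !d_dx_dy by smooth; ring.
Qed.

Lemma iter_dx k l m f : smooth f ->
  Nat.iter m (Laplacian_minus k l) (d_dx f) = d_dx (Nat.iter m (Laplacian_minus k l) f).
Proof.
intros hf; induction m; simpl; trivial; rewrite IHm; apply Laplacian_minus_dx, smooth_iter, hf.
Qed.

Lemma xi_eq k f : xi k f = fun z =>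
  (Ci * ypow k z * Cconj (d_dx f z + Ci * d_dy f z))%C.
Proof.
extensionality z; unfold xi, d_dzbar, ypow; apply C_ext; unfold Re, Im; simpl; field.
Qed.

Lemma smooth_xi k f : smooth f -> smooth (xi k f).
Proof. intros; rewrite xi_eq; smooth. Qed.

Lemma xi_plus k f g : smooth f -> smooth g ->
  xi k (fun z => (f z + g z)%C) = fun z => (xi k f z + xi k g z)%C.
Proof.
intros hf hg; extensionality z; rewrite !xi_eq, d_dx_plus, d_dy_plus by trivial.
apply C_ext; unfold Re, Im; simpl; ring.
Qed.

Lemma xi_scal k c f : smooth f ->
  xi k (fun z => (c * f z)%C) = fun z => (Cconj c * xi k f z)%C.
Proof.
intros hf; extensionality z; rewrite !xi_eq, d_dx_scal, d_dy_scal by trivial.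
apply C_ext; unfold Re, Im; simpl; ring.
Qed.

(** The second-order part comes from [y^(2-k) y^k = y^2]. The first-order part comes from the
    derivative [k y^(k-1)] of the factor [y^k] inside [xi k f], since [y^(2-k) y^(k-1) = y]. The two
    conjugations cancel. *)
Lemma xi_xi k f : smooth f -> xi (2 - k) (xi k f) = Laplacian k f.
Proof.
intros hf; extensionality z.
rewrite (xi_eq k f), (xi_eq (2 - k)), Laplacian_eq.
set (g := fun w => (Ci * ypow k w * Cconj (d_dx f w + Ci * d_dy f w))%C).
erewrite (is_dx_unique g) by (unfold g; is_dx_tac).
erewrite (is_dy_unique g) by (unfold g; is_dy_tac); clear g.
rewrite (d_dx_dy f hf).
(* The products [HA] and [HB] are all that has to be known about the three powers; they can then be
   generalized, which leaves a polynomial identity in each component. *)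
assert (hy := uhp_pos z).
assert (HA : powerRZ (Im z) (2 - k) * powerRZ (Im z) k = Im z * Im z).
{ rewrite <- powerRZ_add by lra; replace (2 - k + k)%Z with 2%Z by lia; simpl; ring. }
assert (HB : powerRZ (Im z) (2 - k) * powerRZ (Im z) (k - 1) = Im z).
{ rewrite <- powerRZ_add by lra; replace (2 - k + (k - 1))%Z with 1%Z by lia; simpl; ring. }
unfold ypow; revert HA HB.
generalize (powerRZ (Im z) (2 - k)) (powerRZ (Im z) k) (powerRZ (Im z) (k - 1)).
replace (powerRZ (Im z) 2) with (Im z * Im z) by (simpl; ring).
replace (powerRZ (Im z) 1) with (Im z) by (simpl; ring).
intros a b c HA HB; apply C_ext; unfold Re, Im in *; simpl; ring [HA HB].
Qed.

(** Both [xi k] after [Laplacian k] and [Laplacian (2 - k)] after [xi k] are the triple composite of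
    [xi k], [xi (2 - k)], [xi k]. The eigenvalue is conjugated because [xi k] is
    conjugate-linear. *)
Lemma xi_Laplacian_minus k l f : smooth f ->
  xi k (Laplacian_minus k l f) = Laplacian_minus (2 - k) (Cconj l) (xi k f).
Proof.
intros hf; unfold Laplacian_minus.
replace (fun z => (Laplacian k f z - l * f z)%C)
  with (fun z => (Laplacian k f z + (- l) * f z)%C) by (extensionality z; ring).
rewrite xi_plus, xi_scal, <- (xi_xi k f hf) by (try apply smooth_Laplacian; smooth).
rewrite <- (xi_xi (2 - k) (xi k f) (smooth_xi k f hf)).
replace (2 - (2 - k))%Z with k by lia.
extensionality z; apply C_ext; unfold Re, Im; simpl; ring.
Qed.

Lemma xi_iter k l m f : smooth f ->
  xi k (Nat.iter m (Laplacian_minus k l) f) =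
  Nat.iter m (Laplacian_minus (2 - k) (Cconj l)) (xi k f).
Proof.
intros hf; induction m; [reflexivity|]; rewrite !Nat.iter_succ, <- IHm; apply xi_Laplacian_minus, smooth_iter, hf.
Qed.

Lemma xi_zero k : xi k (fun _ => RtoC 0) = fun _ => RtoC 0.
Proof.
extensionality z; rewrite xi_eq, (is_dx_unique _ _ _ (is_dx_const _ z)),
  (is_dy_unique _ _ _ (is_dy_const _ z)); apply C_ext; unfold Re, Im; simpl; ring.
Qed.

(** * Integrals over a period box *)

(** Only the real part is integrated, so energy densities may be written with complex algebra and
    their imaginary parts disregarded. The interval is one period, placed with its right end at
    [x0], the abscissa at which pointwise values are later recovered. *)
Definition hint (x0 : R) (g : ℍ -> C) (y : R) : R := RInt (fun x => re2 g x y) (x0 - 1) x0.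

Definition dint (x0 a b : R) (g : ℍ -> C) : R := RInt (hint x0 g) a b.

Lemma is_derive_re2_x g x y (h : 0 < y) : smooth g ->
  is_derive (fun t => re2 g t y) x (re2 (d_dx g) x y).
Proof.
intros hg; pose proof (proj1 (is_dx_smooth g (UHP (x, y) h) hg)) as H.
rewrite (uhp_2d (d_dx g)) in H; exact H.
Qed.

Lemma is_derive_re2_y g x y (h : 0 < y) : smooth g ->
  is_derive (fun t => re2 g x t) y (re2 (d_dy g) x y).
Proof.
intros hg; pose proof (proj1 (is_dy_smooth g (UHP (x, y) h) hg)) as H.
rewrite (uhp_2d (d_dy g)) in H; exact H.
Qed.

Lemma ex_RInt_re2 g a b y : 0 < y -> smooth g -> ex_RInt (fun x => re2 g x y) a b.
Proof.
intros hy hg; apply (ex_RInt_continuous (V := R_CompleteNormedModule)); intros x _.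
apply (ex_derive_continuous (fun t => re2 g t y) x).
eexists; apply is_derive_re2_x; assumption.
Qed.

Lemma continuity_2d_pt_swap (F : R -> R -> R) x y :
  continuity_2d_pt F x y -> continuity_2d_pt (fun u v => F v u) y x.
Proof. intros h eps; destruct (h eps) as [d hd]; exists d; intros u v hu hv; apply hd; trivial. Qed.

(** Differentiation under the integral sign, justified by the joint continuity of the
    [y]-derivative. *)
Lemma is_derive_hint x0 g y : 0 < y -> smooth g ->
  is_derive (hint x0 g) y (hint x0 (d_dy g) y).
Proof.
intros hy hg.
replace (hint x0 (d_dy g) y)
  with (RInt (fun x => Derive (fun t => re2 g x t) y) (x0 - 1) x0).
2:{ apply RInt_ext; intros x _; apply is_derive_unique, is_derive_re2_y; trivial. }
apply (is_derive_RInt_param (fun t x => re2 g x t) (x0 - 1) x0 y).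
- generalize (locally_pos y hy); apply filter_imp; intros t ht x _.
  eexists; apply is_derive_re2_y; trivial.
- intros x _; apply continuity_2d_pt_swap with (F := fun v u => Derive (fun z => re2 g v z) u).
  apply continuity_2d_pt_ext_loc with (re2 (d_dy g)).
  + apply locally_2d_pos; trivial; intros u v hv; symmetry.
    apply is_derive_unique, is_derive_re2_y; trivial.
  + apply continuousH_2d; trivial; apply smooth_cont, smooth_dy, hg.
- generalize (locally_pos y hy); apply filter_imp; intros t ht; apply ex_RInt_re2; trivial.
Qed.

Lemma continuous_hint x0 g y : 0 < y -> smooth g -> continuous (hint x0 g) y.
Proof.
intros hy hg; apply (ex_derive_continuous (hint x0 g) y).
eexists; apply is_derive_hint; trivial.
Qed.

Lemma ex_RInt_hint x0 a b g : 0 < a -> a <= b -> smooth g -> ex_RInt (hint x0 g) a b.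
Proof.
intros ha hab hg; apply (ex_RInt_continuous (V := R_CompleteNormedModule)).
rewrite Rmin_left, Rmax_right by trivial; intros y hy; apply continuous_hint; trivial; lra.
Qed.

Lemma dint_plus x0 a b f g : 0 < a -> a <= b -> smooth f -> smooth g ->
  dint x0 a b (fun z => (f z + g z)%C) = dint x0 a b f + dint x0 a b g.
Proof.
intros ha hab hf hg; unfold dint.
rewrite <- (RInt_plus (hint x0 f) (hint x0 g)) by (apply ex_RInt_hint; trivial).
apply RInt_ext; rewrite Rmin_left, Rmax_right by trivial; intros y hy.
assert (h : 0 < y) by lra; unfold hint.
rewrite <- (RInt_plus (fun x => re2 f x y) (fun x => re2 g x y)) by (apply ex_RInt_re2; trivial).
apply RInt_ext; intros x _; unfold re2; rewrite !(extend_pos _ x y h); reflexivity.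
Qed.

Lemma dint_scal x0 a b c f : 0 < a -> a <= b -> smooth f ->
  dint x0 a b (fun z => (RtoC c * f z)%C) = c * dint x0 a b f.
Proof.
intros ha hab hf; unfold dint.
refine (eq_trans _ (RInt_scal (V := R_CompleteNormedModule) (hint x0 f) a b c
  (ex_RInt_hint x0 a b f ha hab hf))).
apply RInt_ext; rewrite Rmin_left, Rmax_right by trivial; intros y hy.
assert (h : 0 < y) by lra; unfold hint.
refine (eq_trans _ (RInt_scal (V := R_CompleteNormedModule) (fun x => re2 f x y) _ _ c
  (ex_RInt_re2 f _ _ y h hf))).
apply RInt_ext; intros x _; unfold re2; rewrite !(extend_pos _ x y h).
unfold scal, Re; simpl; unfold mult; simpl; ring.
Qed.

Definition in_box (x0 a b : R) (z : ℍ) : Prop :=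
  x0 - 1 <= Re z <= x0 /\ a <= Im z <= b.

Lemma dint_le x0 a b f g : 0 < a -> a <= b -> smooth f -> smooth g ->
  (forall z, in_box x0 a b z -> Re (f z) <= Re (g z)) ->
  dint x0 a b f <= dint x0 a b g.
Proof.
intros ha hab hf hg H; apply RInt_le; trivial; try (apply ex_RInt_hint; trivial).
intros y hy; assert (h : 0 < y) by lra.
apply RInt_le; [lra| | |]; try (apply ex_RInt_re2; trivial).
intros x hx; unfold re2; rewrite !(extend_pos _ x y h); apply H; split; simpl; lra.
Qed.

Lemma dint_const x0 a b c : 0 < a -> a <= b ->
  dint x0 a b (fun _ => RtoC c) = c * (b - a).
Proof.
intros ha hab; unfold dint.
rewrite (RInt_ext _ (fun _ => c)).
- rewrite RInt_const; unfold scal; simpl; unfold mult; simpl; ring.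
- rewrite Rmin_left, Rmax_right by trivial; intros y hy; assert (h : 0 < y) by lra.
  unfold hint; rewrite (RInt_ext _ (fun _ => c)).
  + rewrite RInt_const; unfold scal; simpl; unfold mult; simpl; ring.
  + intros x _; unfold re2; rewrite (extend_pos _ x y h); reflexivity.
Qed.

Lemma dint_dy x0 a b g : 0 < a -> a <= b -> smooth g ->
  dint x0 a b (d_dy g) = hint x0 g b - hint x0 g a.
Proof.
intros ha hab hg; apply (is_RInt_unique (V := R_CompleteNormedModule)).
apply (is_RInt_derive (V := R_CompleteNormedModule) (hint x0 g) (hint x0 (d_dy g)) a b);
  rewrite Rmin_left, Rmax_right by trivial; intros y hy.
- apply is_derive_hint; trivial; lra.
- apply continuous_hint; [lra | apply smooth_dy, hg].
Qed.

Lemma hint_dx x0 g y : 0 < y -> smooth g ->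
  hint x0 (d_dx g) y = re2 g x0 y - re2 g (x0 - 1) y.
Proof.
intros hy hg; apply (is_RInt_unique (V := R_CompleteNormedModule)).
apply (is_RInt_derive (V := R_CompleteNormedModule) (fun x => re2 g x y) (fun x => re2 (d_dx g) x y));
  intros x _.
- apply is_derive_re2_x; trivial.
- apply (ex_derive_continuous (fun t => re2 (d_dx g) t y) x).
  eexists; apply is_derive_re2_x; [trivial | apply smooth_dx, hg].
Qed.

(** * Periodicity in [x] *)

Definition periodic (f : ℍ -> C) : Prop :=
  forall x y (h : 0 < y), f (UHP (x + 1, y) h) = f (UHP (x, y) h).

Lemma periodic_mult f g : periodic f -> periodic g -> periodic (fun z => (f z * g z)%C).
Proof. intros hf hg x y h; rewrite hf, hg; reflexivity. Qed.

Lemma periodic_conj f : periodic f -> periodic (fun z => Cconj (f z)).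
Proof. intros hf x y h; rewrite hf; reflexivity. Qed.

Lemma periodic_extend f x y : periodic f -> extend f (x + 1, y) = extend f (x, y).
Proof.
intros hf; unfold extend; simpl; destruct (Rlt_dec 0 y) as [h | h]; [apply hf | reflexivity].
Qed.

Lemma periodic_dy f : periodic f -> periodic (d_dy f).
Proof.
intros hf x y h; unfold d_dy, DeriveC, along_y; simpl.
f_equal; apply Derive_ext; intros t; rewrite periodic_extend; trivial.
Qed.

Lemma periodic_dx f : smooth f -> periodic f -> periodic (d_dx f).
Proof.
intros hs hf x y h; apply is_dx_unique.
destruct (is_dx_smooth f (UHP (x, y) h) hs) as [h1 h2]; simpl in *.
assert (T : forall F : R -> R, (forall t, F (t + 1) = F t) -> forall l,
   is_derive F x l -> is_derive F (x + 1) l).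
{ clear; intros F hF l hl.
  apply (is_derive_ext (fun t => F (t - 1))).
  { intros t; rewrite <- (hF (t - 1)); f_equal; ring. }
  replace l with (scal 1 l) by (unfold scal; simpl; unfold mult; simpl; ring).
  apply (is_derive_comp F (fun t => t - 1) (x + 1)).
  - replace (x + 1 - 1) with x by ring; exact hl.
  - auto_derive; trivial; ring. }
split; apply T; try assumption; intros t; unfold re2, im2; simpl; rewrite periodic_extend; trivial.
Qed.

Lemma dint_dx x0 a b g : 0 < a -> a <= b -> smooth g -> periodic g ->
  dint x0 a b (d_dx g) = 0.
Proof.
intros ha hab hg hp; unfold dint.
rewrite (RInt_ext _ (fun _ => 0)).
- rewrite RInt_const; unfold scal; simpl; unfold mult; simpl; ring.
- rewrite Rmin_left, Rmax_right by trivial; intros y hy.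
  rewrite hint_dx by (trivial; lra); unfold re2.
  rewrite <- (periodic_extend g (x0 - 1) y hp); replace (x0 - 1 + 1) with x0 by ring.
  apply Rminus_diag.
Qed.

Lemma hint_zero x0 g y : 0 < y -> (forall x h, g (UHP (x, y) h) = RtoC 0) -> hint x0 g y = 0.
Proof.
intros hy H; unfold hint; rewrite (RInt_ext _ (fun _ => 0)).
- rewrite RInt_const; unfold scal; simpl; unfold mult; simpl; ring.
- intros x _; unfold re2; rewrite (extend_pos _ x y hy), H; reflexivity.
Qed.

(** * Weighted energy estimates *)

Definition wnorm (x0 y0 : R) (n : nat) (u : ℍ -> C) : R :=
  dint x0 (y0 - 1) (y0 + 1) (fun z => (cutoff y0 n z * (u z * Cconj (u z)))%C).

(** This is the expanded divergence of the vector field [e^p conj(w) grad u] with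
    [e = 1 - (y - y0)^2]; the last summand is the one where the derivative falls on the cutoff. *)
Definition green_density (y0 : R) (p : nat) (w u : ℍ -> C) : ℍ -> C := fun z =>
  (cutoff y0 p z * (Cconj (w z) * (d_dx (d_dx u) z + d_dy (d_dy u) z))
   + cutoff y0 p z * (Cconj (d_dx w z) * d_dx u z + Cconj (d_dy w z) * d_dy u z)
   + RtoC (INR p) * cutoff y0 (pred p) z * (RtoC (-2) * (ypow 1 z - RtoC y0))
       * (Cconj (w z) * d_dy u z))%C.

Lemma smooth_green y0 p w u : smooth w -> smooth u -> smooth (green_density y0 p w u).
Proof. intros; unfold green_density; smooth. Qed.

(** The flux through the vertical sides cancels by periodicity. The flux through the horizontal
    sides vanishes because [e = 0] at [y0 - 1] and [y0 + 1], which is where [p >= 1] enters. *)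
Lemma green_zero x0 y0 p w u : 2 <= y0 -> (1 <= p)%nat -> smooth w -> smooth u ->
  periodic w -> periodic u ->
  dint x0 (y0 - 1) (y0 + 1) (green_density y0 p w u) = 0.
Proof.
intros hy hp hw hu pw pu.
set (F := fun z => (cutoff y0 p z * (Cconj (w z) * d_dx u z))%C).
set (G := fun z => (cutoff y0 p z * (Cconj (w z) * d_dy u z))%C).
assert (hF : smooth F) by (unfold F; smooth).
assert (hG : smooth G) by (unfold G; smooth).
replace (green_density y0 p w u) with (fun z => (d_dx F z + d_dy G z)%C).
2:{ extensionality z; unfold green_density.
    erewrite (is_dx_unique F) by (unfold F; is_dx_tac).
    erewrite (is_dy_unique G) by (unfold G; is_dy_tac); ring. }
rewrite dint_plus, dint_dx, dint_dy by (try lra; smooth; unfold F;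
  repeat apply periodic_mult; try apply periodic_conj; try apply periodic_dx; trivial;
  intros x y h; reflexivity).
rewrite !hint_zero; try lra.
all: intros x h; unfold G, cutoff; simpl;
  match goal with |- (RtoC (?a ^ ?n) * _)%C = _ => replace (a ^ n) with 0; [ring|] end.
all: replace (1 - _) with 0 by ring; symmetry; apply pow_ne_zero; lia.
Qed.

Lemma Re_RtoC_mult (r : R) (c : C) : Re (RtoC r * c) = r * Re c.
Proof. unfold Re; simpl; ring. Qed.

Lemma Re_plus (a b : C) : Re (a + b) = Re a + Re b.
Proof. reflexivity. Qed.

Lemma Re_mult_conj (c : C) : Re (c * Cconj c) = Cmod c ^ 2.
Proof. rewrite <- Cmod2_conj; reflexivity. Qed.

Lemma Rabs_Re_le (c : C) : Rabs (Re c) <= Cmod c.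
Proof. apply Rle_trans with (2 := Rmax_Cmod c); apply Rmax_l. Qed.

Lemma Re_conj_mult_ge (a b : C) : - (Cmod a * Cmod b) <= Re (Cconj a * b).
Proof.
rewrite <- (Cmod_conj a), <- Cmod_mult.
pose proof (Rabs_Re_le (Cconj a * b)) as H; apply Rabs_le_between in H; lra.
Qed.

Lemma cutoff_base_bounds y0 x0 z : in_box x0 (y0 - 1) (y0 + 1) z ->
  0 <= 1 - (Im z - y0) ^ 2 <= 1.
Proof. intros [_ [h1 h2]]; set (t := Im z) in *; pose proof (pow2_ge_0 (t - y0)); split; nra. Qed.

(** Only the summand with the differentiated cutoff is estimated, by [|-2 (y - y0)| <= 2]; the
    others are kept exactly. *)
Lemma Re_green y0 x0 p w u z : in_box x0 (y0 - 1) (y0 + 1) z ->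
  let e := 1 - (Im z - y0) ^ 2 in
  e ^ p * Re (Cconj (w z) * (d_dx (d_dx u) z + d_dy (d_dy u) z))
  - e ^ p * (- Re (Cconj (d_dx w z) * d_dx u z) - Re (Cconj (d_dy w z) * d_dy u z))
  - 2 * INR p * e ^ pred p * (Cmod (w z) * Cmod (d_dy u z))
  <= Re (green_density y0 p w u z).
Proof.
intros hz e; pose proof (cutoff_base_bounds _ _ _ hz) as he; fold e in he.
unfold green_density; rewrite !Re_plus.
replace (RtoC (INR p) * cutoff y0 (pred p) z * (RtoC (-2) * (ypow 1 z - RtoC y0))
   * (Cconj (w z) * d_dy u z))%C
  with (RtoC (INR p * e ^ pred p * (-2 * (Im z - y0))) * (Cconj (w z) * d_dy u z))%C.
2:{ unfold cutoff, ypow; fold e; rewrite powerRZ_1, !RtoC_mult, RtoC_minus; reflexivity. }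
unfold cutoff; fold e; rewrite !Re_RtoC_mult, Re_plus.
assert (H : - (2 * INR p * e ^ pred p * (Cmod (w z) * Cmod (d_dy u z)))
   <= INR p * e ^ pred p * (-2 * (Im z - y0)) * Re (Cconj (w z) * d_dy u z)).
{ assert (H1 : Rabs (-2 * (Im z - y0)) <= 2).
  { destruct hz as [_ hz]; apply Rabs_le; lra. }
  assert (H2 : Rabs (Re (Cconj (w z) * d_dy u z)) <= Cmod (w z) * Cmod (d_dy u z)).
  { rewrite <- (Cmod_conj (w z)), <- Cmod_mult; apply Rabs_Re_le. }
  assert (H3 : 0 <= INR p * e ^ pred p)
    by (apply Rmult_le_pos; [apply pos_INR | apply pow_le; lra]).
  assert (H4 := Rmult_le_compat _ _ _ _ (Rabs_pos _) (Rabs_pos _) H1 H2).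
  rewrite <- Rabs_mult in H4; apply Rabs_le_between in H4.
  assert (H5 := Rmult_le_compat_l _ _ _ H3 (proj1 H4)); lra. }
lra.
Qed.

(** Solve the equation for the flat Laplacian by dividing by [y^2]. The coefficient [r] is
    [y0^2 / y^2], which lies in [[4/9, 4]] because [y0/2 <= y <= 3 y0/2]. The remainder [c] collects
    the lower-order terms, whose factors [1/y] and [1/y^2] are at most 1 because [y >= 1]. *)
Lemma euclidean_laplacian_bound k l y0 x0 u v z : 2 <= y0 -> in_box x0 (y0 - 1) (y0 + 1) z ->
  Laplacian_minus k l u = (fun z => (RtoC (y0 ^ 2) * v z)%C) ->
  exists (r : R) (c : C), 4 / 9 <= r <= 4 /\
  Cmod c <= (Rabs (IZR k) + Cmod l) * (Cmod (u z) + Cmod (d_dx u z) + Cmod (d_dy u z)) /\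
  (d_dx (d_dx u) z + d_dy (d_dy u) z)%C = (RtoC r * v z + c)%C.
Proof.
intros hy hz E; apply (f_equal (fun g => g z)) in E.
unfold Laplacian_minus, Laplacian in E; destruct hz as [_ [hz1 hz2]].
set (y := Im z) in *; assert (hy0 : 1 <= y) by lra.
exists (y0 ^ 2 / y ^ 2).
exists (RtoC (/ y ^ 2) * (l * u z) + RtoC (/ y) * (Ci * RtoC (IZR k) * (d_dx u z + Ci * d_dy u z)))%C.
assert (h1 : 0 < y ^ 2) by nra.
split; [|split].
- assert (a1 : y * y <= 3 / 2 * y0 * (3 / 2 * y0)) by (apply Rmult_le_compat; lra).
  assert (a2 : y0 * y0 <= 2 * y * (2 * y)) by (apply Rmult_le_compat; lra).
  split; [apply (Rle_div_r (4 / 9)) | apply (Rle_div_l (y0 ^ 2))]; trivial; simpl; lra.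
- eapply Rle_trans; [apply Cmod_triangle|].
  rewrite !Cmod_mult, !Cmod_R, Cmod_Ci.
  assert (i1 : Rabs (/ y ^ 2) <= 1).
  { rewrite Rabs_pos_eq by (left; apply Rinv_0_lt_compat; lra).
    rewrite <- Rinv_1; apply Rinv_le_contravar; nra. }
  assert (i2 : Rabs (/ y) <= 1).
  { rewrite Rabs_pos_eq by (left; apply Rinv_0_lt_compat; lra).
    rewrite <- Rinv_1; apply Rinv_le_contravar; lra. }
  assert (t : Cmod (d_dx u z + Ci * d_dy u z) <= Cmod (d_dx u z) + Cmod (d_dy u z)).
  { eapply Rle_trans; [apply Cmod_triangle|]; rewrite Cmod_mult, Cmod_Ci; lra. }
  assert (j1 := Cmod_ge_0 l); assert (j2 := Cmod_ge_0 (u z)); assert (j3 := Rabs_pos (IZR k)).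
  assert (j4 := Cmod_ge_0 (d_dx u z + Ci * d_dy u z)).
  assert (j5 := Cmod_ge_0 (d_dx u z)); assert (j6 := Cmod_ge_0 (d_dy u z)).
  assert (k1 := Rmult_le_compat_r _ _ _ (Rmult_le_pos _ _ j1 j2) i1).
  assert (k2 := Rmult_le_compat_r _ _ _ (Rmult_le_pos _ _ j3 j4) i2).
  assert (k3 := Rmult_le_compat_l _ _ _ j3 t).
  nra.
- assert (hyC : RtoC y <> RtoC 0) by (intros h; apply RtoC_inj in h; lra).
  assert (E2 : (RtoC (y0 ^ 2) * v z = RtoC y ^ 2 * (d_dx (d_dx u) z + d_dy (d_dy u) z)
     - Ci * RtoC (IZR k) * RtoC y * (d_dx u z + Ci * d_dy u z) - l * u z)%C) by (symmetry; exact E).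
  replace (y0 ^ 2 / y ^ 2) with (/ y ^ 2 * y0 ^ 2) by (field; lra).
  rewrite RtoC_mult, <- Cmult_assoc, E2, !RtoC_inv, RtoC_pow by lra; field; exact hyC.
Qed.

Lemma weighted_amgm (d a b : R) : 0 < d -> 2 * (a * b) <= d * a ^ 2 + b ^ 2 / d.
Proof.
intros hd; assert (H : 0 <= (d * a - b) ^ 2 / d)
  by (apply Rmult_le_pos; [apply pow2_ge_0 | left; apply Rinv_0_lt_compat; lra]).
replace ((d * a - b) ^ 2 / d) with (d * a ^ 2 + b ^ 2 / d - 2 * (a * b)) in H by (field; lra); lra.
Qed.

(** The integrand inequality with the common factor [e^q] removed; [U, X, Y, V] stand for the moduli
    of [u, u_x, u_y, v], and [r] for the real part of [conj(u)] times the flat Laplacian. Each of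
    [e X] and [e Y] is paired with a multiple of [U] at cost one half of its square, so half of the
    gradient term survives on the left. *)
Lemma caccioppoli_real (e K M d U X Y V r : R) : 0 <= e <= 1 -> 0 <= K -> 0 <= M -> 0 < d ->
  0 <= U -> 0 <= X -> 0 <= Y -> 0 <= V ->
  - (U * (4 * V + K * (U + X + Y))) <= r ->
  / 2 * (e ^ 2 * (X ^ 2 + Y ^ 2)) <=
  d * (e ^ 4 * V ^ 2) + (4 / d + K + K ^ 2 / 2 + (K + M) ^ 2 / 2) * U ^ 2
  + (e ^ 2 * r + e ^ 2 * (X ^ 2 + Y ^ 2) - M * e * (U * Y)).
Proof.
intros [he0 he1] hK hM hd hU hX hY hV hr.
assert (A1 := weighted_amgm d (e ^ 2 * V) (2 * U) hd).
assert (A2 := weighted_amgm 1 (e * X) (K * U) Rlt_0_1).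
assert (A3 := weighted_amgm 1 (e * Y) ((K + M) * U) Rlt_0_1).
assert (he2 : 0 <= e ^ 2) by apply pow2_ge_0.
assert (hr2 := Rmult_le_compat_l _ _ _ he2 hr).
assert (e2 : e ^ 2 <= e) by nra.
assert (B1 : e ^ 2 * (K * U * U) <= K * U ^ 2).
{ replace (K * U ^ 2) with (1 * (K * U * U)) by ring.
  apply Rmult_le_compat_r; [repeat apply Rmult_le_pos; trivial | lra]. }
assert (B2 : e ^ 2 * (K * U * X) <= e * (K * U * X))
  by (apply Rmult_le_compat_r; [repeat apply Rmult_le_pos; trivial | lra]).
assert (B3 : e ^ 2 * (K * U * Y) <= e * (K * U * Y))
  by (apply Rmult_le_compat_r; [repeat apply Rmult_le_pos; trivial | lra]).
replace ((2 * U) ^ 2 / d) with (4 / d * U ^ 2) in A1 by (field; lra).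
replace (e ^ 4) with (e ^ 2 * e ^ 2) by ring.
lra.
Qed.

(** As before, but tested with [v], so the main term is [4/9 V^2]. The products of [V] with [U], [X]
    and [Y] are split with parameter [2/27] and cost [1/27] each, and [4/9 - 3/27 = 1/3]. The mixed
    gradient term [e^4 X' X] is split as [e^3 X'] times [e X], which lets [X'] carry the small
    factor [d]. *)
Lemma second_energy_real (e K M d U X Y V X' Y' r s : R) :
  0 <= e <= 1 -> 0 <= K -> 0 <= M -> 0 < d ->
  0 <= U -> 0 <= X -> 0 <= Y -> 0 <= V -> 0 <= X' -> 0 <= Y' ->
  4 / 9 * V ^ 2 - V * (K * (U + X + Y)) <= r ->
  - (X' * X + Y' * Y) <= s ->
  / 3 * (e ^ 4 * V ^ 2) <=
  d * (e ^ 6 * (X' ^ 2 + Y' ^ 2))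
  + (27 / 4 * (K + M) ^ 2 + / (4 * d)) * (U ^ 2 + e ^ 2 * (X ^ 2 + Y ^ 2))
  + (e ^ 4 * r + e ^ 4 * s - M * e ^ 3 * (V * Y)).
Proof.
intros [he0 he1] hK hM hd hU hX hY hV hX' hY' hr hs.
assert (h27 : 0 < 2 / 27) by lra.
assert (A1 := weighted_amgm _ (e ^ 2 * V) (K * U) h27).
assert (A2 := weighted_amgm _ (e ^ 2 * V) (K * (e * X)) h27).
assert (A3 := weighted_amgm _ (e ^ 2 * V) ((K + M) * (e * Y)) h27).
assert (hd2 : 0 < 2 * d) by lra.
assert (A4 := weighted_amgm _ (e ^ 3 * X') (e * X) hd2).
assert (A5 := weighted_amgm _ (e ^ 3 * Y') (e * Y) hd2).
assert (he4 : 0 <= e ^ 4) by (apply pow_le; lra).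
assert (hr2 := Rmult_le_compat_l _ _ _ he4 hr).
assert (hs2 := Rmult_le_compat_l _ _ _ he4 hs).
assert (e21 : e ^ 2 <= 1) by nra.
assert (e2 : 0 <= e ^ 2) by apply pow2_ge_0.
assert (e42 : e ^ 4 <= e ^ 2) by nra.
assert (e43 : e ^ 4 <= e ^ 3) by (assert (0 <= e ^ 3) by (apply pow_le; lra); nra).
assert (B1 : e ^ 4 * (K * U * V) <= e ^ 2 * (K * U * V))
  by (apply Rmult_le_compat_r; [repeat apply Rmult_le_pos; trivial | lra]).
assert (B2 : e ^ 4 * (K * X * V) <= e ^ 3 * (K * X * V))
  by (apply Rmult_le_compat_r; [repeat apply Rmult_le_pos; trivial | lra]).
assert (B3 : e ^ 4 * (K * Y * V) <= e ^ 3 * (K * Y * V))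
  by (apply Rmult_le_compat_r; [repeat apply Rmult_le_pos; trivial | lra]).
assert (KM : K ^ 2 <= (K + M) ^ 2) by nra.
assert (C1 : K ^ 2 * U ^ 2 <= (K + M) ^ 2 * U ^ 2)
  by (apply Rmult_le_compat_r; [apply pow2_ge_0 | lra]).
assert (C2 : K ^ 2 * (e * X) ^ 2 <= (K + M) ^ 2 * (e * X) ^ 2)
  by (apply Rmult_le_compat_r; [apply pow2_ge_0 | lra]).
assert (hd4 : 0 < / (4 * d)) by (apply Rinv_0_lt_compat; lra).
assert (D1 : 0 <= / (4 * d) * U ^ 2) by (apply Rmult_le_pos; [lra | apply pow2_ge_0]).
replace ((e * X) ^ 2 / (2 * d)) with (2 * (/ (4 * d) * (e * X) ^ 2)) in A4 by (field; lra).
replace ((e * Y) ^ 2 / (2 * d)) with (2 * (/ (4 * d) * (e * Y) ^ 2)) in A5 by (field; lra).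
replace ((K * U) ^ 2 / (2 / 27)) with (27 / 2 * (K ^ 2 * U ^ 2)) in A1 by field.
replace ((K * (e * X)) ^ 2 / (2 / 27)) with (27 / 2 * (K ^ 2 * (e * X) ^ 2)) in A2 by field.
replace (((K + M) * (e * Y)) ^ 2 / (2 / 27)) with (27 / 2 * ((K + M) ^ 2 * (e * Y) ^ 2)) in A3 by field.
lra.
Qed.

Definition scaled_image (k : Z) (l : C) (y0 : R) (u v : ℍ -> C) : Prop :=
  Laplacian_minus k l u = fun z => (RtoC (y0 ^ 2) * v z)%C.

(** Green's formula tested with [u] itself: the divergence integrates to zero, so it may be added to
    the right side of the pointwise inequality before integrating. The factor [d / 2] anticipates
    the multiplication by 2 that clears the [1/2] on the left. *)
Lemma caccioppoli (k : Z) (l : C) (q : nat) (d : R) : 0 < d ->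
  exists B, 0 <= B /\ forall x0 y0 u v, 2 <= y0 -> smooth u -> smooth v -> periodic u ->
  scaled_image k l y0 u v ->
  wnorm x0 y0 (q + 2) (d_dx u) + wnorm x0 y0 (q + 2) (d_dy u)
  <= d * wnorm x0 y0 (q + 4) v + B * wnorm x0 y0 q u.
Proof.
intros hd; set (K := Rabs (IZR k) + Cmod l); set (M := 2 * INR (q + 2)).
assert (hK : 0 <= K) by (apply Rplus_le_le_0_compat; [apply Rabs_pos | apply Cmod_ge_0]).
assert (hM : 0 <= M) by (apply Rmult_le_pos; [lra | apply pos_INR]).
assert (hd2 : 0 < d / 2) by lra.
set (B := 4 / (d / 2) + K + K ^ 2 / 2 + (K + M) ^ 2 / 2).
assert (hB : 0 <= B).
{ assert (0 < 4 / (d / 2)) by (apply Rdiv_lt_0_compat; lra).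
  pose proof (pow2_ge_0 K); pose proof (pow2_ge_0 (K + M)); unfold B; lra. }
exists (2 * B); split; [lra|]; intros x0 y0 u v hy hu hv pu E.
assert (H : dint x0 (y0 - 1) (y0 + 1) (fun z => (RtoC (/ 2) *
    (cutoff y0 (q + 2) z * (d_dx u z * Cconj (d_dx u z))
     + cutoff y0 (q + 2) z * (d_dy u z * Cconj (d_dy u z))))%C)
  <= dint x0 (y0 - 1) (y0 + 1) (fun z => (RtoC (d / 2) * (cutoff y0 (q + 4) z * (v z * Cconj (v z)))
     + RtoC B * (cutoff y0 q z * (u z * Cconj (u z)))
     + green_density y0 (q + 2) u u z)%C)).
{ apply dint_le; try lra; try (smooth; apply smooth_green; trivial).
  intros z hz; pose proof (Re_green y0 x0 (q + 2) u u z hz) as G; cbv zeta in G.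
  rewrite !Re_plus, !Re_RtoC_mult, !Re_plus.
  pose proof (cutoff_base_bounds _ _ _ hz) as he; unfold cutoff.
  rewrite !Re_RtoC_mult, !Re_mult_conj.
  set (e := 1 - (Im z - y0) ^ 2) in *.
  destruct (euclidean_laplacian_bound k l y0 x0 u v z hy hz E) as (r & c & hr & hc & El).
  fold K in hc; rewrite El in G.
  rewrite (Cmult_comm (Cconj (d_dx u z))), (Cmult_comm (Cconj (d_dy u z))), !Re_mult_conj in G.
  assert (R1 : - (Cmod (u z) * (4 * Cmod (v z) + K * (Cmod (u z) + Cmod (d_dx u z) + Cmod (d_dy u z))))
     <= Re (Cconj (u z) * (RtoC r * v z + c))).
  { eapply Rle_trans; [|apply Re_conj_mult_ge]; apply Ropp_le_contravar, Rmult_le_compat_l;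
      [apply Cmod_ge_0|].
    eapply Rle_trans; [apply Cmod_triangle|]; apply Rplus_le_compat; trivial.
    rewrite Cmod_mult, Cmod_R, Rabs_pos_eq by lra; apply Rmult_le_compat_r; [apply Cmod_ge_0 | lra]. }
  pose proof (caccioppoli_real e K M (d / 2) _ _ _ _ _ he hK hM hd2 (Cmod_ge_0 (u z))
    (Cmod_ge_0 (d_dx u z)) (Cmod_ge_0 (d_dy u z)) (Cmod_ge_0 (v z)) R1) as P; fold B in P.
  assert (hq : 0 <= e ^ q) by (apply pow_le; lra).
  apply (Rmult_le_compat_l _ _ _ hq) in P.
  replace (pred (q + 2)) with (q + 1)%nat in G by lia.
  fold M in G; rewrite !pow_add in *; lra. }
rewrite (dint_scal _ _ _ (/ 2)), (dint_plus _ _ _ _ (green_density y0 (q + 2) u u)),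
  !dint_plus, !dint_scal, green_zero in H
  by (trivial; try lra; try lia; smooth; apply smooth_green; trivial).
unfold wnorm; lra.
Qed.

(** Green's formula for [u] tested with its image [v]. No second derivative of [u] appears in the
    bound, since the flat Laplacian is replaced by a multiple of [v] plus lower order; the price is
    a small multiple of the gradient of [v]. *)
Lemma second_energy (k : Z) (l : C) (q : nat) (d : R) : 0 < d ->
  exists B, 0 <= B /\ forall x0 y0 u v, 2 <= y0 -> smooth u -> smooth v -> periodic u -> periodic v ->
  scaled_image k l y0 u v ->
  wnorm x0 y0 (q + 4) v
  <= d * (wnorm x0 y0 (q + 6) (d_dx v) + wnorm x0 y0 (q + 6) (d_dy v))
     + B * (wnorm x0 y0 q u + (wnorm x0 y0 (q + 2) (d_dx u) + wnorm x0 y0 (q + 2) (d_dy u))).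
Proof.
intros hd; set (K := Rabs (IZR k) + Cmod l); set (M := 2 * INR (q + 4)).
assert (hK : 0 <= K) by (apply Rplus_le_le_0_compat; [apply Rabs_pos | apply Cmod_ge_0]).
assert (hM : 0 <= M) by (apply Rmult_le_pos; [lra | apply pos_INR]).
assert (hd2 : 0 < d / 3) by lra.
set (B := 27 / 4 * (K + M) ^ 2 + / (4 * (d / 3))).
assert (hB : 0 <= B).
{ assert (0 < / (4 * (d / 3))) by (apply Rinv_0_lt_compat; lra).
  pose proof (pow2_ge_0 (K + M)); unfold B; lra. }
exists (3 * B); split; [lra|]; intros x0 y0 u v hy hu hv pu pv E.
assert (H : dint x0 (y0 - 1) (y0 + 1) (fun z => (RtoC (/ 3) *
    (cutoff y0 (q + 4) z * (v z * Cconj (v z))))%C)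
  <= dint x0 (y0 - 1) (y0 + 1) (fun z => (RtoC (d / 3) *
      (cutoff y0 (q + 6) z * (d_dx v z * Cconj (d_dx v z))
       + cutoff y0 (q + 6) z * (d_dy v z * Cconj (d_dy v z)))
     + RtoC B * (cutoff y0 q z * (u z * Cconj (u z))
       + (cutoff y0 (q + 2) z * (d_dx u z * Cconj (d_dx u z))
       + cutoff y0 (q + 2) z * (d_dy u z * Cconj (d_dy u z))))
     + green_density y0 (q + 4) v u z)%C)).
{ apply dint_le; try lra; try (smooth; apply smooth_green; trivial).
  intros z hz; pose proof (Re_green y0 x0 (q + 4) v u z hz) as G; cbv zeta in G.
  rewrite !Re_plus, !Re_RtoC_mult, !Re_plus.
  pose proof (cutoff_base_bounds _ _ _ hz) as he; unfold cutoff.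
  rewrite !Re_RtoC_mult, !Re_mult_conj.
  set (e := 1 - (Im z - y0) ^ 2) in *.
  destruct (euclidean_laplacian_bound k l y0 x0 u v z hy hz E) as (r & c & hr & hc & El).
  fold K in hc; rewrite El in G.
  assert (R1 : 4 / 9 * Cmod (v z) ^ 2
      - Cmod (v z) * (K * (Cmod (u z) + Cmod (d_dx u z) + Cmod (d_dy u z)))
     <= Re (Cconj (v z) * (RtoC r * v z + c))).
  { replace (Cconj (v z) * (RtoC r * v z + c))%C
      with (RtoC r * (v z * Cconj (v z)) + Cconj (v z) * c)%C by ring.
    rewrite Re_plus, Re_RtoC_mult, Re_mult_conj; apply Rplus_le_compat.
    - apply Rmult_le_compat_r; [apply pow2_ge_0 | lra].
    - eapply Rle_trans; [|apply Re_conj_mult_ge]; apply Ropp_le_contravar, Rmult_le_compat_l;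
      [apply Cmod_ge_0 | trivial]. }
  assert (R2 : - (Cmod (d_dx v z) * Cmod (d_dx u z) + Cmod (d_dy v z) * Cmod (d_dy u z))
     <= Re (Cconj (d_dx v z) * d_dx u z) + Re (Cconj (d_dy v z) * d_dy u z)).
  { rewrite Ropp_plus_distr; apply Rplus_le_compat; apply Re_conj_mult_ge. }
  pose proof (second_energy_real e K M (d / 3) _ _ _ _ _ _ _ _ he hK hM hd2 (Cmod_ge_0 (u z))
    (Cmod_ge_0 (d_dx u z)) (Cmod_ge_0 (d_dy u z)) (Cmod_ge_0 (v z))
    (Cmod_ge_0 (d_dx v z)) (Cmod_ge_0 (d_dy v z)) R1 R2) as P; fold B in P.
  assert (hq : 0 <= e ^ q) by (apply pow_le; lra).
  apply (Rmult_le_compat_l _ _ _ hq) in P.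
  replace (pred (q + 4)) with (q + 3)%nat in G by lia.
  fold M in G; rewrite !pow_add in *; lra. }
rewrite (dint_scal _ _ _ (/ 3)), (dint_plus _ _ _ _ (green_density y0 (q + 4) v u)),
  dint_plus, !dint_scal, !dint_plus, green_zero in H
  by (trivial; try lra; try lia; smooth; apply smooth_green; trivial).
unfold wnorm; lra.
Qed.

Lemma wnorm_mono x0 y0 n n' f : 2 <= y0 -> smooth f -> (n <= n')%nat ->
  wnorm x0 y0 n' f <= wnorm x0 y0 n f.
Proof.
intros hy hf hn; apply dint_le; try lra; smooth; intros z hz.
unfold cutoff; rewrite !Re_RtoC_mult, Re_mult_conj.
apply Rmult_le_compat_r; [apply pow2_ge_0|].
destruct (cutoff_base_bounds _ _ _ hz) as [h0 h1].
replace n' with (n + (n' - n))%nat by lia; rewrite pow_add.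
rewrite <- (Rmult_1_r (_ ^ n)) at 2; apply Rmult_le_compat_l; [apply pow_le, h0|].
apply Rle_trans with (1 ^ (n' - n)); [apply pow_incr; split; trivial | rewrite pow1; lra].
Qed.

Lemma wnorm_nonneg x0 y0 n f : 2 <= y0 -> smooth f -> 0 <= wnorm x0 y0 n f.
Proof.
intros hy hf.
replace 0 with (0 * ((y0 + 1) - (y0 - 1))) by ring.
rewrite <- (dint_const x0 (y0 - 1) (y0 + 1) 0) by lra.
apply dint_le; try lra; smooth; intros z hz.
unfold cutoff; rewrite Re_RtoC_mult, Re_mult_conj; change (Re (RtoC 0)) with 0.
apply Rmult_le_pos; [apply pow_le, (cutoff_base_bounds _ _ _ hz) | apply pow2_ge_0].
Qed.

(** Both gradients in [second_energy] are removed by [caccioppoli], applied to the pairs [(v, w)]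
    and [(u, v)]. Each application returns a multiple of the norm of [v], to be absorbed on the
    left. *)
Lemma energy_interpolation (k : Z) (l : C) (q : nat) (eps : R) : 0 < eps ->
  exists B, 0 <= B /\ forall x0 y0 u v w, 2 <= y0 -> smooth u -> smooth v -> smooth w ->
  periodic u -> periodic v -> scaled_image k l y0 u v -> scaled_image k l y0 v w ->
  wnorm x0 y0 (q + 4) v <= eps * wnorm x0 y0 (q + 8) w + B * wnorm x0 y0 q u.
Proof.
intros heps.
destruct (caccioppoli k l (q + 4) 1 Rlt_0_1) as (B1 & hB1 & H1).
replace (q + 4 + 2)%nat with (q + 6)%nat in H1 by lia.
replace (q + 4 + 4)%nat with (q + 8)%nat in H1 by lia.
assert (he : 0 < / eps) by (apply Rinv_0_lt_compat; trivial).
(* The order of choices matters: [B1] is fixed before [d], then [B2] depends on [d], [d'] on [B2]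
   and [B3] on [d']. They ensure [d B1 <= 1/4] and [B2 d' <= 1/4], so half of the norm of [v] is
   absorbed, and [d <= eps / 4]. *)
set (d := / (4 * (B1 + 1 + / eps))).
assert (hd : 0 < d) by (apply Rinv_0_lt_compat; lra).
assert (Hd : d * (4 * (B1 + 1 + / eps)) = 1) by (unfold d; apply Rinv_l; lra).
destruct (second_energy k l q d hd) as (B2 & hB2 & H2).
set (d' := / (4 * (B2 + 1))).
assert (hd' : 0 < d') by (apply Rinv_0_lt_compat; lra).
assert (Hd' : d' * (4 * (B2 + 1)) = 1) by (unfold d'; apply Rinv_l; lra).
destruct (caccioppoli k l q d' hd') as (B3 & hB3 & H3).
exists (2 * (B2 * (1 + B3))); split; [repeat apply Rmult_le_pos; lra|].
intros x0 y0 u v w hy hu hv hw pu pv E E'.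
specialize (H1 x0 y0 v w hy hv hw pv E').
specialize (H2 x0 y0 u v hy hu hv pu pv E).
specialize (H3 x0 y0 u v hy hu hv pu E).
assert (P1 := wnorm_nonneg x0 y0 (q + 4) v hy hv).
assert (P2 := wnorm_nonneg x0 y0 (q + 8) w hy hw).
set (Gv := wnorm x0 y0 (q + 4) v) in *; set (Gw := wnorm x0 y0 (q + 8) w) in *.
assert (K1 := Rmult_le_compat_l _ _ _ (Rlt_le _ _ hd) H1).
assert (K2 := Rmult_le_compat_l _ _ _ hB2 H3).
assert (s1 : d * B1 <= / 4) by (assert (0 <= d * / eps) by (apply Rmult_le_pos; lra); lra).
assert (s2 : B2 * d' <= / 4) by lra.
assert (s3 : d <= eps / 4).
{ assert (s : d * / eps <= / 4) by (assert (0 <= d * B1) by (apply Rmult_le_pos; lra); lra).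
  replace d with (d * / eps * eps) by (field; lra).
  assert (t := Rmult_le_compat_r eps _ _ (Rlt_le _ _ heps) s); lra. }
assert (t1 := Rmult_le_compat_r _ _ _ P1 s1).
assert (t2 := Rmult_le_compat_r _ _ _ P1 s2).
assert (t3 := Rmult_le_compat_r _ _ _ P2 s3).
assert (t4 : 0 <= eps * Gw) by (apply Rmult_le_pos; lra).
lra.
Qed.

(** * Derivatives of solutions bounded by the solution *)

Definition descale (k : Z) (l : C) (y0 : R) (u : ℍ -> C) : ℍ -> C :=
  fun z => (RtoC (/ y0 ^ 2) * Laplacian_minus k l u z)%C.

Lemma descale_image k l y0 u : 2 <= y0 -> scaled_image k l y0 u (descale k l y0 u).
Proof.
intros hy; unfold scaled_image, descale; extensionality z.
rewrite Cmult_assoc, <- RtoC_mult, Rinv_r by (apply pow_nonzero; lra); ring.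
Qed.

Lemma smooth_descale k l y0 u : smooth u -> smooth (descale k l y0 u).
Proof.
intros; apply smooth_mult; [apply smooth_const | apply smooth_Laplacian_minus; trivial].
Qed.

Lemma periodic_Laplacian_minus k l u : smooth u -> periodic u -> periodic (Laplacian_minus k l u).
Proof.
intros hu pu x y h; unfold Laplacian_minus, Laplacian; cbn [Im uhp_val snd].
rewrite !(periodic_dx _ hu pu), !(periodic_dy _ pu), pu.
rewrite (periodic_dx _ (smooth_dx _ hu) (periodic_dx _ hu pu)).
rewrite (periodic_dy _ (periodic_dy _ pu)); reflexivity.
Qed.

Lemma periodic_descale k l y0 u : smooth u -> periodic u -> periodic (descale k l y0 u).
Proof.
intros hu pu x y h; unfold descale; rewrite (periodic_Laplacian_minus k l u hu pu); reflexivity.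
Qed.

(* Downward induction on the iterates [v, Lv, L^2 v, ...], the last of which vanishes. *)
Lemma image_energy_of_iter k l m : forall q, exists B, 0 <= B /\
  forall x0 y0 u v, 2 <= y0 -> smooth u -> smooth v ->
  periodic u -> periodic v -> scaled_image k l y0 u v ->
  Nat.iter m (Laplacian_minus k l) v = (fun _ => RtoC 0) ->
  wnorm x0 y0 (q + 4) v <= B * wnorm x0 y0 q u.
Proof.
induction m as [|m IH]; intros q.
- exists 0; split; [lra|]; intros x0 y0 u v hy hu hv pu pv E hm; simpl in hm; subst v.
  apply Rle_trans with (dint x0 (y0 - 1) (y0 + 1) (fun _ => RtoC 0));
    [|rewrite dint_const by lra; right; ring].
  apply dint_le; try lra; smooth; intros z hz.
  right; unfold Re; simpl; ring.
- destruct (IH (q + 4)%nat) as (B1 & hB1 & H1).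
  replace (q + 4 + 4)%nat with (q + 8)%nat in H1 by lia.
  (* The induction hypothesis bounds [w] by [B1] times the norm of [v]; since [eps B1 <= 1/2], this
     contribution is absorbed. *)
  set (eps := / (2 * (B1 + 1))).
  assert (heps : 0 < eps) by (apply Rinv_0_lt_compat; lra).
  assert (Heps : eps * (2 * (B1 + 1)) = 1) by (unfold eps; apply Rinv_l; lra).
  destruct (energy_interpolation k l q eps heps) as (B2 & hB2 & H2).
  exists (2 * B2); split; [lra|]; intros x0 y0 u v hy hu hv pu pv E hm.
  set (w := descale k l y0 v).
  assert (hw : smooth w) by (apply smooth_descale; trivial).
  assert (pw : periodic w) by (apply periodic_descale; trivial).
  assert (E' : scaled_image k l y0 v w) by (apply descale_image; trivial).
  specialize (H2 x0 y0 u v w hy hu hv hw pu pv E E').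
  assert (H3 : wnorm x0 y0 (q + 8) w <= B1 * wnorm x0 y0 (q + 4) v).
  { apply H1; trivial; unfold w, descale.
    rewrite iter_scal by (apply smooth_Laplacian_minus; trivial).
    rewrite <- Nat.iter_succ_r, hm; extensionality z; ring. }
  assert (K := Rmult_le_compat_l _ _ _ (Rlt_le _ _ heps) H3).
  assert (P := wnorm_nonneg x0 y0 (q + 4) v hy hv).
  assert (s : eps * B1 <= / 2) by lra.
  assert (t := Rmult_le_compat_r _ _ _ P s); lra.
Qed.

(** What the local estimates use of membership in [V]: growth is left out and modularity enters only
    through the translation by 1. *)
Definition periodic_solution (k : Z) (l : C) (m : nat) (u : ℍ -> C) : Prop :=
  smooth u /\ periodic u /\ Nat.iter m (Laplacian_minus k l) u = (fun _ => RtoC 0).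

Definition controlled (k : Z) (l : C) (m q n : nat) (T : (ℍ -> C) -> ℍ -> C) : Prop :=
  exists B, 0 <= B /\ forall x0 y0 u, 2 <= y0 -> periodic_solution k l m u ->
  wnorm x0 y0 n (T u) <= B * wnorm x0 y0 q u.

Lemma periodic_solution_dx k l m u :
  periodic_solution k l m u -> periodic_solution k l m (d_dx u).
Proof.
intros (hu & pu & hm); split; [smooth|]; split; [apply periodic_dx; trivial|].
rewrite iter_dx, hm by trivial; extensionality z; apply is_dx_unique, is_dx_const.
Qed.

(** The bound for [T] may be applied to [d_dx u] because that is again a solution; hence [d_dx]
    always stands innermost in the iterated operators. *)
Lemma controlled_dx_comp k l m q n p T : controlled k l m q n d_dx -> controlled k l m n p T ->
  controlled k l m q p (fun u => T (d_dx u)).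
Proof.
intros (B1 & hB1 & H1) (B2 & hB2 & H2); exists (B2 * B1); split; [apply Rmult_le_pos; trivial|].
intros x0 y0 u hy hu.
eapply Rle_trans; [apply H2; trivial; apply periodic_solution_dx; trivial|].
rewrite Rmult_assoc; apply Rmult_le_compat_l; auto.
Qed.

Lemma controlled_mono k l m q n n' T : (forall u, smooth u -> smooth (T u)) -> (n <= n')%nat ->
  controlled k l m q n T -> controlled k l m q n' T.
Proof.
intros hT hn (B & hB & H); exists B; split; trivial; intros x0 y0 u hy hu.
eapply Rle_trans; [apply wnorm_mono; eauto|]; [apply hT, hu | apply H; trivial].
Qed.

Lemma controlled_image k l m q : exists B, 0 <= B /\ forall x0 y0 u, 2 <= y0 ->
  periodic_solution k l m u -> wnorm x0 y0 (q + 4) (descale k l y0 u) <= B * wnorm x0 y0 q u.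
Proof.
destruct (image_energy_of_iter k l m q) as (B & hB & H); exists B; split; trivial.
intros x0 y0 u hy (hu & pu & hm); apply H; trivial;
  [apply smooth_descale | apply periodic_descale | apply descale_image |]; trivial.
unfold descale; rewrite iter_scal by (apply smooth_Laplacian_minus; trivial).
rewrite <- Nat.iter_succ_r, Nat.iter_succ, hm; extensionality z.
unfold Laplacian_minus; rewrite Laplacian_eq.
rewrite (is_dx_unique _ _ _ (is_dx_const (RtoC 0) z)), (is_dy_unique _ _ _ (is_dy_const (RtoC 0) z)).
replace (d_dx (fun _ => RtoC 0)) with (fun _ : ℍ => RtoC 0)
  by (extensionality w; symmetry; apply is_dx_unique, is_dx_const).
replace (d_dy (fun _ => RtoC 0)) with (fun _ : ℍ => RtoC 0)
  by (extensionality w; symmetry; apply is_dy_unique, is_dy_const).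
rewrite (is_dx_unique _ _ _ (is_dx_const (RtoC 0) z)), (is_dy_unique _ _ _ (is_dy_const (RtoC 0) z)).
ring.
Qed.

Lemma controlled_gradient k l m q : exists B, 0 <= B /\ forall x0 y0 u, 2 <= y0 ->
  periodic_solution k l m u ->
  wnorm x0 y0 (q + 2) (d_dx u) + wnorm x0 y0 (q + 2) (d_dy u) <= B * wnorm x0 y0 q u.
Proof.
destruct (controlled_image k l m q) as (B1 & hB1 & H1).
destruct (caccioppoli k l q 1 Rlt_0_1) as (B2 & hB2 & H2).
exists (B1 + B2); split; [lra|]; intros x0 y0 u hy (hu & pu & hm).
specialize (H2 x0 y0 u (descale k l y0 u) hy hu (smooth_descale _ _ _ _ hu) pu
  (descale_image _ _ _ _ hy)).
specialize (H1 x0 y0 u hy (conj hu (conj pu hm))); lra.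
Qed.

Lemma controlled_dx k l m q : controlled k l m q (q + 2) d_dx.
Proof.
destruct (controlled_gradient k l m q) as (B & hB & H); exists B; split; trivial.
intros x0 y0 u hy hu; specialize (H x0 y0 u hy hu).
assert (P := wnorm_nonneg x0 y0 (q + 2) (d_dy u) hy (smooth_dy _ (proj1 hu))); lra.
Qed.

Lemma controlled_dy k l m q : controlled k l m q (q + 2) d_dy.
Proof.
destruct (controlled_gradient k l m q) as (B & hB & H); exists B; split; trivial.
intros x0 y0 u hy hu; specialize (H x0 y0 u hy hu).
assert (P := wnorm_nonneg x0 y0 (q + 2) (d_dx u) hy (smooth_dx _ (proj1 hu))); lra.
Qed.

(** The equation gives [u_yy = r v + c - u_xx], and all three terms are already controlled. *)
Lemma controlled_dydy k l m q : controlled k l m q (q + 4) (fun u => d_dy (d_dy u)).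
Proof.
destruct (controlled_image k l m q) as (B1 & hB1 & H1).
destruct (controlled_gradient k l m q) as (B2 & hB2 & H2).
destruct (controlled_dx_comp k l m q (q + 2) (q + 4) d_dx) as (B3 & hB3 & H3).
{ apply controlled_dx. }
{ replace (q + 4)%nat with (q + 2 + 2)%nat by lia; apply controlled_dx. }
set (K := Rabs (IZR k) + Cmod l).
assert (hK : 0 <= 9 * K ^ 2) by (pose proof (pow2_ge_0 K); lra).
exists (48 * B1 + 9 * K ^ 2 * (1 + B2) + 3 * B3); split.
{ assert (0 <= 9 * K ^ 2 * (1 + B2)) by (apply Rmult_le_pos; lra); lra. }
intros x0 y0 u hy hs; specialize (H1 x0 y0 u hy hs); specialize (H2 x0 y0 u hy hs);
  specialize (H3 x0 y0 u hy hs); destruct hs as (hu & pu & hm).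
set (v := descale k l y0 u) in *.
assert (hv : smooth v) by (apply smooth_descale; trivial).
assert (H : wnorm x0 y0 (q + 4) (d_dy (d_dy u)) <= dint x0 (y0 - 1) (y0 + 1) (fun z =>
    (RtoC 48 * (cutoff y0 (q + 4) z * (v z * Cconj (v z)))
     + RtoC (9 * K ^ 2) * (cutoff y0 q z * (u z * Cconj (u z))
       + (cutoff y0 (q + 2) z * (d_dx u z * Cconj (d_dx u z))
       + cutoff y0 (q + 2) z * (d_dy u z * Cconj (d_dy u z))))
     + RtoC 3 * (cutoff y0 (q + 4) z * (d_dx (d_dx u) z * Cconj (d_dx (d_dx u) z))))%C)).
{ apply dint_le; try lra; smooth; intros z hz.
  rewrite !Re_plus, !Re_RtoC_mult, !Re_plus.
  pose proof (cutoff_base_bounds _ _ _ hz) as he; unfold cutoff.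
  rewrite !Re_RtoC_mult, !Re_mult_conj.
  set (e := 1 - (Im z - y0) ^ 2) in *.
  destruct (euclidean_laplacian_bound k l y0 x0 u v z hy hz (descale_image _ _ _ _ hy))
    as (r & c & hr & hc & El); fold K in hc.
  replace (d_dy (d_dy u) z) with (RtoC r * v z + c - d_dx (d_dx u) z)%C by (rewrite <- El; ring).
  assert (T : Cmod (RtoC r * v z + c - d_dx (d_dx u) z)
    <= 4 * Cmod (v z) + K * (Cmod (u z) + Cmod (d_dx u z) + Cmod (d_dy u z)) + Cmod (d_dx (d_dx u) z)).
  { eapply Rle_trans; [apply Cmod_triangle|]; rewrite Cmod_opp; apply Rplus_le_compat_r.
    eapply Rle_trans; [apply Cmod_triangle|]; apply Rplus_le_compat; trivial.
    rewrite Cmod_mult, Cmod_R, Rabs_pos_eq by lra; apply Rmult_le_compat_r; [apply Cmod_ge_0 | lra]. }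
  set (U := Cmod (u z)) in *; set (X := Cmod (d_dx u z)) in *; set (Y := Cmod (d_dy u z)) in *.
  set (V := Cmod (v z)) in *; set (W := Cmod (d_dx (d_dx u) z)) in *.
  assert (T2 := pow_incr _ _ 2 (conj (Cmod_ge_0 _) T)).
  set (t := Cmod (RtoC r * v z + c - d_dx (d_dx u) z) ^ 2) in *.
  (* The square of a sum of three terms is at most three times the sum of their squares:
     [48 = 3 (4^2)], and the estimate is used twice for [9 K^2]. *)
  assert (T3 : t <= 48 * V ^ 2 + 9 * K ^ 2 * (U ^ 2 + (X ^ 2 + Y ^ 2)) + 3 * W ^ 2).
  { eapply Rle_trans; [exact T2|].
    pose proof (pow2_ge_0 (4 * V - K * (U + X + Y))); pose proof (pow2_ge_0 (4 * V - W)).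
    pose proof (pow2_ge_0 (K * (U + X + Y) - W)).
    pose proof (pow2_ge_0 (K * (U - X))); pose proof (pow2_ge_0 (K * (U - Y))).
    pose proof (pow2_ge_0 (K * (X - Y))); lra. }
  assert (hq : 0 <= e ^ q) by (apply pow_le; lra).
  assert (e4 : 0 <= e ^ 4) by (apply pow_le; lra).
  assert (e2 : 0 <= e ^ 2 <= 1) by (split; [apply pow2_ge_0 | rewrite <- (pow1 2); apply pow_incr; lra]).
  assert (e42 : e ^ 4 <= e ^ 2) by (replace (e ^ 4) with (e ^ 2 * e ^ 2) by ring; nra).
  apply (Rmult_le_compat_l _ _ _ e4) in T3.
  assert (a1 : e ^ 4 * (9 * K ^ 2 * U ^ 2) <= 1 * (9 * K ^ 2 * U ^ 2))
    by (apply Rmult_le_compat_r; [apply Rmult_le_pos; [lra | apply pow2_ge_0] | lra]).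
  assert (a2 : e ^ 4 * (9 * K ^ 2 * (X ^ 2 + Y ^ 2)) <= e ^ 2 * (9 * K ^ 2 * (X ^ 2 + Y ^ 2))).
  { apply Rmult_le_compat_r; [apply Rmult_le_pos; [lra|] | lra].
    apply Rplus_le_le_0_compat; apply pow2_ge_0. }
  assert (T4 : e ^ 4 * t <= 48 * (e ^ 4 * V ^ 2)
      + 9 * K ^ 2 * (U ^ 2 + (e ^ 2 * X ^ 2 + e ^ 2 * Y ^ 2)) + 3 * (e ^ 4 * W ^ 2)) by lra.
  apply (Rmult_le_compat_l _ _ _ hq) in T4; rewrite !pow_add; lra. }
rewrite !dint_plus, !dint_scal, !dint_plus in H by (try lra; smooth).
assert (K2 := Rmult_le_compat_l _ _ _ hK H2).
unfold wnorm in *; lra.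
Qed.

(** * Pointwise gradient bound *)

Lemma dint_subset x0 a b c g : 0 < a -> a <= b <= c -> smooth g ->
  (forall z, in_box x0 a c z -> 0 <= Re (g z)) -> dint x0 a b g <= dint x0 a c g.
Proof.
intros ha [hab hbc] hg H; unfold dint.
rewrite <- (RInt_Chasles (hint x0 g) a b c) by (apply ex_RInt_hint; trivial; lra).
change (plus ?r ?s) with (r + s).
assert (P : 0 <= RInt (hint x0 g) b c); [|lra].
apply RInt_ge_0; [lra | apply ex_RInt_hint; trivial; lra|].
intros y hy; assert (h : 0 < y) by lra; apply RInt_ge_0; [lra | apply ex_RInt_re2; trivial|].
intros x hx; unfold re2; rewrite (extend_pos _ x y h); apply H; split; simpl; lra.
Qed.

Lemma Re_weighted_mult_conj_le (a A : R) (p q : C) : Rabs a <= A ->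
  Re (RtoC a * (p * Cconj q)) <= A * (Cmod p ^ 2 + Cmod q ^ 2) / 2.
Proof.
intros ha; eapply Rle_trans; [apply Rle_abs|]; eapply Rle_trans; [apply Rabs_Re_le|].
rewrite !Cmod_mult, Cmod_R, Cmod_conj.
assert (hp := Cmod_ge_0 p); assert (hq := Cmod_ge_0 q).
assert (H := Rmult_le_compat_r _ _ _ (Rmult_le_pos _ _ hp hq) ha).
assert (hA : 0 <= A) by (eapply Rle_trans; [apply Rabs_pos | exact ha]).
assert (G : 0 <= A * (Cmod p - Cmod q) ^ 2) by (apply Rmult_le_pos; [trivial | apply pow2_ge_0]).
lra.
Qed.

(* [|g|^2] at the corner [(x0, y0)] is the integral of [d_y d_x] of [|g|^2] times a weight
   that vanishes on the left and bottom sides of the box. *)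
Lemma sobolev_box g x0 y0 (h : 0 < y0) : 2 <= y0 -> smooth g ->
  Cmod (g (UHP (x0, y0) h)) ^ 2 <=
  30 * (wnorm x0 y0 6 g + wnorm x0 y0 6 (d_dx g) + wnorm x0 y0 6 (d_dy g)
        + wnorm x0 y0 6 (d_dy (d_dx g))).
Proof.
intros hy hg.
set (s := fun z => ((xcoord z - RtoC (x0 - 1)) * (cutoff y0 7 z * (g z * Cconj (g z))))%C).
assert (hs : smooth s) by (unfold s; smooth).
set (D := fun z => (cutoff y0 6 z * (g z * Cconj (g z)) + cutoff y0 6 z * (d_dx g z * Cconj (d_dx g z))
  + cutoff y0 6 z * (d_dy g z * Cconj (d_dy g z))
  + cutoff y0 6 z * (d_dy (d_dx g) z * Cconj (d_dy (d_dx g) z)))%C).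
assert (hD : smooth D) by (unfold D; smooth).
assert (E1 : dint x0 (y0 - 1) y0 (d_dy (d_dx s)) = Cmod (g (UHP (x0, y0) h)) ^ 2).
{ rewrite dint_dy, !hint_dx by (try lra; smooth).
  unfold re2; assert (h' : 0 < y0 - 1) by lra.
  rewrite !(extend_pos s _ _ h), !(extend_pos s _ _ h').
  rewrite <- Re_mult_conj; unfold s, cutoff, xcoord; generalize (g (UHP (x0, y0) h)); intros c.
  unfold Re, Im; simpl; ring. }
(* The constant 30 is the coefficient of [|g|^2]: differentiating [e^7] produces [-14 (y - y0) e^6],
   of size at most 14, which contributes 14 from the term in [|g|^2] and 14 from those with [g_x];
   those with [g_y] and [g_xy] contribute 1 each. The other squares receive less. One power of [e]
   is lost, whence weight 7 in [s] and 6 in the norms. *)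
assert (E2 : forall z, in_box x0 (y0 - 1) y0 z -> Re (d_dy (d_dx s) z) <= Re (RtoC 30 * D z)).
{ intros z hz; assert (hz' : in_box x0 (y0 - 1) (y0 + 1) z)
    by (destruct hz as [? ?]; split; [trivial | lra]).
  pose proof (cutoff_base_bounds _ _ _ hz') as he.
  replace (d_dx s) with (fun z => (cutoff y0 7 z * (g z * Cconj (g z)) +
     (xcoord z - RtoC (x0 - 1)) * (cutoff y0 7 z * (d_dx g z * Cconj (g z) + g z * Cconj (d_dx g z))))%C).
  2:{ extensionality w; symmetry; apply is_dx_unique; unfold s; evar_last; [is_dx_tac | ring]. }
  erewrite is_dy_unique by is_dy_tac.
  set (e := 1 - (Im z - y0) ^ 2) in *.
  set (t := -14 * (Im z - y0)); set (tau := Re z - (x0 - 1)).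
  assert (htau : 0 <= tau <= 1) by (destruct hz; unfold tau; lra).
  assert (ht : Rabs t <= 14) by (destruct hz; apply Rabs_le; unfold t; lra).
  set (G := g z); set (Gx := d_dx g z); set (Gy := d_dy g z); set (Gxy := d_dy (d_dx g) z).
  match goal with |- Re ?c <= _ => replace c with
    (RtoC (e ^ 6 * t) * (G * Cconj G) + RtoC (e ^ 7) * (Gy * Cconj G) + RtoC (e ^ 7) * (G * Cconj Gy)
     + RtoC (tau * e ^ 6 * t) * (Gx * Cconj G) + RtoC (tau * e ^ 6 * t) * (G * Cconj Gx)
     + RtoC (tau * e ^ 7) * (Gxy * Cconj G) + RtoC (tau * e ^ 7) * (Gx * Cconj Gy)
     + RtoC (tau * e ^ 7) * (Gy * Cconj Gx) + RtoC (tau * e ^ 7) * (G * Cconj Gxy))%C end.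
  2:{ unfold cutoff, ypow, xcoord; fold e G Gx Gy Gxy; unfold t, tau.
      rewrite powerRZ_1; apply C_ext; unfold Re, Im; simpl; ring. }
  rewrite Re_RtoC_mult; unfold D, cutoff; fold e G Gx Gy Gxy.
  rewrite !Re_plus, !Re_RtoC_mult, !Re_mult_conj.
  assert (he6 : 0 <= e ^ 6) by (apply pow_le; lra).
  assert (b7 : 0 <= e ^ 7 <= e ^ 6) by (replace (e ^ 7) with (e * e ^ 6) by ring; nra).
  assert (a1 : Rabs (e ^ 6 * t) <= 14 * e ^ 6)
    by (rewrite Rabs_mult, Rabs_pos_eq by trivial; nra).
  assert (a2 : Rabs (e ^ 7) <= e ^ 6) by (rewrite Rabs_pos_eq; lra).
  assert (a3 : Rabs (tau * e ^ 6 * t) <= 14 * e ^ 6).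
  { rewrite Rmult_assoc, Rabs_mult, (Rabs_pos_eq tau) by lra.
    pose proof (Rabs_pos (e ^ 6 * t)); nra. }
  assert (a4 : Rabs (tau * e ^ 7) <= e ^ 6) by (rewrite Rabs_pos_eq; nra).
  pose proof (Re_weighted_mult_conj_le _ _ G G a1) as P1.
  pose proof (Re_weighted_mult_conj_le _ _ Gy G a2) as P2.
  pose proof (Re_weighted_mult_conj_le _ _ G Gy a2) as P3.
  pose proof (Re_weighted_mult_conj_le _ _ Gx G a3) as P4.
  pose proof (Re_weighted_mult_conj_le _ _ G Gx a3) as P5.
  pose proof (Re_weighted_mult_conj_le _ _ Gxy G a4) as P6.
  pose proof (Re_weighted_mult_conj_le _ _ Gx Gy a4) as P7.
  pose proof (Re_weighted_mult_conj_le _ _ Gy Gx a4) as P8.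
  pose proof (Re_weighted_mult_conj_le _ _ G Gxy a4) as P9.
  rewrite Re_RtoC_mult, Re_mult_conj in P1; rewrite Re_RtoC_mult in P2, P3, P4, P5, P6, P7, P8, P9.
  assert (0 <= e ^ 6 * Cmod G ^ 2) by (apply Rmult_le_pos; [trivial | apply pow2_ge_0]).
  assert (0 <= e ^ 6 * Cmod Gx ^ 2) by (apply Rmult_le_pos; [trivial | apply pow2_ge_0]).
  assert (0 <= e ^ 6 * Cmod Gy ^ 2) by (apply Rmult_le_pos; [trivial | apply pow2_ge_0]).
  assert (0 <= e ^ 6 * Cmod Gxy ^ 2) by (apply Rmult_le_pos; [trivial | apply pow2_ge_0]).
  lra. }
rewrite <- E1; eapply Rle_trans; [apply dint_le; [| | | |exact E2]; try lra; smooth|].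
eapply Rle_trans; [apply (dint_subset x0 (y0 - 1) y0 (y0 + 1)); try lra; smooth|].
- intros z hz; unfold D, cutoff.
  rewrite Re_RtoC_mult, !Re_plus, !Re_RtoC_mult, !Re_mult_conj.
  assert (he6 := pow_le _ 6 (proj1 (cutoff_base_bounds _ _ _ hz))).
  apply Rmult_le_pos; [lra|]; repeat apply Rplus_le_le_0_compat;
    (apply Rmult_le_pos; [exact he6 | apply pow2_ge_0]).
- rewrite dint_scal by (try lra; smooth); unfold D.
  rewrite !dint_plus by (try lra; smooth); right; reflexivity.
Qed.

(** [sobolev_box] is applied to [u_x] and to [u_y]. With mixed partials commuted, this calls for
    seven derivatives of [u] of order at most three, each controlled from weight 0 to weight 6. *)
Lemma gradient_bound k l m : exists B, 0 <= B /\ forall x0 y0 (h : 0 < y0) u S, 2 <= y0 ->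
  periodic_solution k l m u -> 0 <= S ->
  (forall z, in_box x0 (y0 - 1) (y0 + 1) z -> Cmod (u z) <= S) ->
  Cmod (d_dx u (UHP (x0, y0) h)) <= B * S /\ Cmod (d_dy u (UHP (x0, y0) h)) <= B * S.
Proof.
assert (cx : controlled k l m 0 6 d_dx)
  by (apply controlled_mono with 2%nat; [intros; smooth | lia | apply controlled_dx]).
assert (cy : controlled k l m 0 6 d_dy)
  by (apply controlled_mono with 2%nat; [intros; smooth | lia | apply controlled_dy]).
assert (cxx : controlled k l m 0 6 (fun u => d_dx (d_dx u))).
{ apply controlled_mono with 4%nat; [intros; smooth | lia |].
  exact (controlled_dx_comp k l m 0 2 4 d_dx (controlled_dx k l m 0) (controlled_dx k l m 2)). }
assert (cxy : controlled k l m 0 6 (fun u => d_dy (d_dx u))).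
{ apply controlled_mono with 4%nat; [intros; smooth | lia |].
  exact (controlled_dx_comp k l m 0 2 4 d_dy (controlled_dx k l m 0) (controlled_dy k l m 2)). }
assert (cyy : controlled k l m 0 6 (fun u => d_dy (d_dy u))).
{ apply controlled_mono with 4%nat; [intros; smooth | lia | exact (controlled_dydy k l m 0)]. }
assert (cxxy : controlled k l m 0 6 (fun u => d_dy (d_dx (d_dx u)))).
{ exact (controlled_dx_comp k l m 0 2 6 _ (controlled_dx k l m 0)
    (controlled_dx_comp k l m 2 4 6 d_dy (controlled_dx k l m 2) (controlled_dy k l m 4))). }
assert (cxyy : controlled k l m 0 6 (fun u => d_dy (d_dy (d_dx u)))).
{ exact (controlled_dx_comp k l m 0 2 6 _ (controlled_dx k l m 0) (controlled_dydy k l m 2)). }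
destruct cx as (B1 & p1 & H1), cy as (B2 & p2 & H2), cxx as (B3 & p3 & H3), cxy as (B4 & p4 & H4),
  cyy as (B5 & p5 & H5), cxxy as (B6 & p6 & H6), cxyy as (B7 & p7 & H7).
(* The 30 of [sobolev_box] is doubled so that the squared gradient is at most [B W / 2]; as the box
   has area 2, [W <= 2 S^2] turns this into [B S^2]. Passing to [B + 1] avoids a square root, by
   [B <= (B + 1)^2]. *)
set (B := 60 * (B1 + B2 + B3 + 2 * B4 + B5 + B6 + B7)).
exists (B + 1); split; [unfold B; lra|].
intros x0 y0 h u S hy hs hS hu.
assert (su : smooth u) by apply hs.
assert (N : wnorm x0 y0 0 u <= 2 * S ^ 2).
{ apply Rle_trans with (dint x0 (y0 - 1) (y0 + 1) (fun _ => RtoC (S ^ 2))).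
  - apply dint_le; try lra; smooth; intros z hz; unfold cutoff.
    rewrite Re_RtoC_mult, Re_mult_conj, pow_O, Rmult_1_l.
    apply pow_incr; split; [apply Cmod_ge_0 | apply hu; trivial].
  - rewrite dint_const by lra; right; ring. }
specialize (H1 x0 y0 u hy hs); specialize (H2 x0 y0 u hy hs); specialize (H3 x0 y0 u hy hs);
specialize (H4 x0 y0 u hy hs); specialize (H5 x0 y0 u hy hs); specialize (H6 x0 y0 u hy hs);
specialize (H7 x0 y0 u hy hs).
assert (Gx := sobolev_box (d_dx u) x0 y0 h hy (smooth_dx _ su)).
assert (Gy := sobolev_box (d_dy u) x0 y0 h hy (smooth_dy _ su)).
rewrite !(d_dx_dy u su) in Gy.
set (W := wnorm x0 y0 0 u) in *.
assert (pW : 0 <= W) by (apply wnorm_nonneg; trivial).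
assert (BW : B * W <= 2 * (B * S ^ 2))
  by (replace (2 * (B * S ^ 2)) with (B * (2 * S ^ 2)) by ring;
      apply Rmult_le_compat_l; [unfold B; lra | exact N]).
assert (q1 := Rmult_le_pos _ _ p1 pW); assert (q2 := Rmult_le_pos _ _ p2 pW);
assert (q3 := Rmult_le_pos _ _ p3 pW); assert (q4 := Rmult_le_pos _ _ p4 pW);
assert (q5 := Rmult_le_pos _ _ p5 pW); assert (q6 := Rmult_le_pos _ _ p6 pW);
assert (q7 := Rmult_le_pos _ _ p7 pW).
assert (pB : 0 <= B) by (unfold B; lra).
assert (BS : B * S ^ 2 <= ((B + 1) * S) ^ 2).
{ replace (((B + 1) * S) ^ 2) with ((B + 1) ^ 2 * S ^ 2) by ring.
  apply Rmult_le_compat_r; [apply pow2_ge_0 | nra]. }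
assert (F : forall c, c ^ 2 <= B * W / 2 -> 0 <= c -> c <= (B + 1) * S).
{ intros c hc c0; apply Rsqr_incr_0; [rewrite !Rsqr_pow2; lra | trivial |].
  apply Rmult_le_pos; lra. }
split; apply F; try apply Cmod_ge_0; unfold B; lra.
Qed.

(** * Modularity *)

(** Total differentiability from partial derivatives, one of them continuous; the chain rule along
    the Möbius action needs it. *)
Lemma differentiable_pt_lim_partials (F Fx Fy : R -> R -> R) x y : 0 < y ->
  (forall u v, 0 < v -> is_derive (fun t => F t v) u (Fx u v)) ->
  (forall u v, 0 < v -> is_derive (fun t => F u t) v (Fy u v)) ->
  continuity_2d_pt Fx x y -> differentiable_pt_lim F x y (Fx x y) (Fy x y).
Proof.
intros hy hx hy' hc; apply filterdiff_differentiable_pt_lim.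
apply (is_derive_filterdiff F x y Fx (Fy x y)).
- assert (H : locally_2d (fun u v => is_derive (fun t => F t v) u (Fx u v)) x y)
    by (apply locally_2d_pos; trivial; intros; apply hx; trivial).
  apply locally_2d_locally in H; revert H; apply filter_imp; intros [u v] H; exact H.
- apply hy'; trivial.
- apply continuity_2d_pt_filterlim in hc; exact hc.
Qed.

Lemma is_derive_comp_2d (f : ℍ -> C) (p q : R -> R) (t0 a b : R) (h : 0 < q t0) : smooth f ->
  is_derive p t0 a -> is_derive q t0 b ->
  is_derive (fun t => re2 f (p t) (q t)) t0
    (re2 (d_dx f) (p t0) (q t0) * a + re2 (d_dy f) (p t0) (q t0) * b) /\
  is_derive (fun t => im2 f (p t) (q t)) t0
    (im2 (d_dx f) (p t0) (q t0) * a + im2 (d_dy f) (p t0) (q t0) * b).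
Proof.
intros hf ha hb.
destruct (proj1 (continuousH_2d _) (smooth_cont _ (smooth_dx _ hf)) (p t0) (q t0) h) as [c1 c2].
assert (X : forall u v (hv : 0 < v), is_dx f (UHP (u, v) hv) (re2 (d_dx f) u v, im2 (d_dx f) u v))
  by (intros; rewrite <- (uhp_2d _ u v hv); apply is_dx_smooth; trivial).
assert (Y : forall u v (hv : 0 < v), is_dy f (UHP (u, v) hv) (re2 (d_dy f) u v, im2 (d_dy f) u v))
  by (intros; rewrite <- (uhp_2d _ u v hv); apply is_dy_smooth; trivial).
split; apply is_derive_Reals, derivable_pt_lim_comp_2d; try (apply is_derive_Reals; assumption);
  apply differentiable_pt_lim_partials; trivial; intros u v hv.
- exact (proj1 (X u v hv)).
- exact (proj1 (Y u v hv)).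
- exact (proj2 (X u v hv)).
- exact (proj2 (Y u v hv)).
Qed.

Lemma extend_comp (f : ℍ -> C) (phi : ℍ -> ℍ) x y : 0 < y ->
  extend (fun z => f (phi z)) (x, y) =
  extend f (re2 (fun z => uhp_val (phi z)) x y, im2 (fun z => uhp_val (phi z)) x y).
Proof.
intros h; rewrite (extend_pos _ x y h); symmetry; apply extend_uhp.
unfold re2, im2; rewrite (extend_pos _ x y h); destruct (uhp_val _); reflexivity.
Qed.

Lemma is_dx_comp f (phi : ℍ -> ℍ) z a : smooth f -> is_dx (fun z => uhp_val (phi z)) z a ->
  is_dx (fun z => f (phi z)) z
    (d_dx f (phi z) * RtoC (Re a) + d_dy f (phi z) * RtoC (Im a))%C.
Proof.
intros hf [h1 h2].
assert (e1 := re2_uhp (fun z => uhp_val (phi z)) z).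
assert (e2 := im2_uhp (fun z => uhp_val (phi z)) z); cbv beta in e1, e2.
assert (hp : 0 < im2 (fun z => uhp_val (phi z)) (Re z) (Im z)) by (rewrite e2; apply uhp_pos).
destruct (is_derive_comp_2d f (fun t => re2 (fun z => uhp_val (phi z)) t (Im z))
  (fun t => im2 (fun z => uhp_val (phi z)) t (Im z)) (Re z) _ _ hp hf h1 h2) as [k1 k2]; cbv beta in k1, k2.
rewrite e1, e2, !re2_uhp in k1; rewrite e1, e2, !im2_uhp in k2; split.
- eapply is_derive_ext; [|evar_last; [exact k1 | unfold Re, Im; simpl; ring]].
  intros t; symmetry; exact (f_equal Re (extend_comp f phi t (Im z) (uhp_pos z))).
- eapply is_derive_ext; [|evar_last; [exact k2 | unfold Re, Im; simpl; ring]].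
  intros t; symmetry; exact (f_equal Im (extend_comp f phi t (Im z) (uhp_pos z))).
Qed.

Lemma is_dy_comp f (phi : ℍ -> ℍ) z a : smooth f -> is_dy (fun z => uhp_val (phi z)) z a ->
  is_dy (fun z => f (phi z)) z
    (d_dx f (phi z) * RtoC (Re a) + d_dy f (phi z) * RtoC (Im a))%C.
Proof.
intros hf [h1 h2].
assert (e1 := re2_uhp (fun z => uhp_val (phi z)) z).
assert (e2 := im2_uhp (fun z => uhp_val (phi z)) z); cbv beta in e1, e2.
assert (hp : 0 < im2 (fun z => uhp_val (phi z)) (Re z) (Im z)) by (rewrite e2; apply uhp_pos).
destruct (is_derive_comp_2d f (fun t => re2 (fun z => uhp_val (phi z)) (Re z) t)
  (fun t => im2 (fun z => uhp_val (phi z)) (Re z) t) (Im z) _ _ hp hf h1 h2) as [k1 k2]; cbv beta in k1, k2.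
rewrite e1, e2, !re2_uhp in k1; rewrite e1, e2, !im2_uhp in k2.
assert (L := locally_pos (Im z) (uhp_pos z)); split.
- eapply is_derive_ext_loc; [|evar_last; [exact k1 | unfold Re, Im; simpl; ring]].
  revert L; apply filter_imp; intros t ht.
  symmetry; exact (f_equal Re (extend_comp f phi (Re z) t ht)).
- eapply is_derive_ext_loc; [|evar_last; [exact k2 | unfold Re, Im; simpl; ring]].
  revert L; apply filter_imp; intros t ht.
  symmetry; exact (f_equal Im (extend_comp f phi (Re z) t ht)).
Qed.

(** The Cauchy-Riemann equation in the form [h_y = i h_x], with [a] the complex derivative. *)
Definition is_hol (h : ℍ -> C) (z : ℍ) (a : C) : Prop := is_dx h z a /\ is_dy h z (Ci * a)%C.

Lemma is_hol_const c z : is_hol (fun _ => c) z (RtoC 0).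
Proof.
split; [apply is_dx_const|]; replace (Ci * RtoC 0)%C with (RtoC 0) by ring; apply is_dy_const.
Qed.

Lemma is_hol_id z : is_hol (fun z => uhp_val z) z (RtoC 1).
Proof.
split.
- apply (is_dx_of _ z (fun x _ => x) (fun _ y => y)); [reflexivity| |];
    [apply (is_derive_id (K := R_AbsRing)) | apply @is_derive_const].
- apply (is_dy_of _ z (fun x _ => x) (fun _ y => y)); [reflexivity| |].
  + evar_last; [apply @is_derive_const | unfold Re, zero; simpl; ring].
  + evar_last; [apply (is_derive_id (K := R_AbsRing)) | unfold Im, one; simpl; ring].
Qed.

Lemma is_hol_plus f g z a b : is_hol f z a -> is_hol g z b ->
  is_hol (fun z => (f z + g z)%C) z (a + b)%C.
Proof.
intros [f1 f2] [g1 g2]; split; [apply is_dx_plus; trivial|].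
replace (Ci * (a + b))%C with (Ci * a + Ci * b)%C by ring; apply is_dy_plus; trivial.
Qed.

Lemma is_hol_mult f g z a b : is_hol f z a -> is_hol g z b ->
  is_hol (fun z => (f z * g z)%C) z (a * g z + f z * b)%C.
Proof.
intros [f1 f2] [g1 g2]; split; [apply is_dx_mult; trivial|].
replace (Ci * (a * g z + f z * b))%C with (Ci * a * g z + f z * (Ci * b))%C by ring.
apply is_dy_mult; trivial.
Qed.

(** The rule [(1/h)' = - h'/h^2] along a real parameter, in the components used by the definition of
    [Cinv]. *)
Lemma is_derive_Cinv (p q : R -> R) (t a b : R) : p t ^ 2 + q t ^ 2 <> 0 ->
  is_derive p t a -> is_derive q t b ->
  is_derive (fun s => p s / (p s ^ 2 + q s ^ 2)) t
    (Re (- ((a, b) / ((p t, q t) * (p t, q t)))%C)) /\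
  is_derive (fun s => - q s / (p s ^ 2 + q s ^ 2)) t
    (Im (- ((a, b) / ((p t, q t) * (p t, q t)))%C)).
Proof.
intros hn ha hb.
assert (ea : ex_derive p t) by (exists a; exact ha).
assert (eb : ex_derive q t) by (exists b; exact hb).
assert (hn2 : (p t * p t - q t * q t) ^ 2 + (p t * q t + q t * p t) ^ 2 <> 0).
{ replace (_ + _) with ((p t ^ 2 + q t ^ 2) ^ 2) by ring; apply pow_nonzero, hn. }
assert (da := is_derive_unique p t a ha); assert (db := is_derive_unique q t b hb).
split; (auto_derive;
  [ repeat split; trivial; intros h0; apply hn; rewrite <- h0; ring
  | change (fun x : R => p x) with p; change (fun x : R => q x) with q;
    rewrite da, db; unfold Re, Im; simpl in *; field; split; intros h0;
    [apply hn2 | apply hn]; rewrite <- h0; ring ]).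
Qed.

Lemma Cmod2_neq_0 (c : C) : c <> RtoC 0 -> Re c ^ 2 + Im c ^ 2 <> 0.
Proof.
intros hc h; apply hc; apply C_ext; unfold Re, Im in *; simpl in *; nra.
Qed.

Lemma is_hol_inv f z a : (forall z, f z <> RtoC 0) -> is_hol f z a ->
  is_hol (fun z => (/ f z)%C) z (- (a / (f z * f z)))%C.
Proof.
intros hf [[f1 f2] [f3 f4]].
assert (N := Cmod2_neq_0 _ (hf z)); rewrite <- (re2_uhp f), <- (im2_uhp f) in N.
set (F := fun x y => re2 f x y / (re2 f x y ^ 2 + im2 f x y ^ 2)).
set (G := fun x y => - im2 f x y / (re2 f x y ^ 2 + im2 f x y ^ 2)).
assert (E : forall x y h, (/ f (UHP (x, y) h))%C = (F x y, G x y))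
  by (intros; rewrite uhp_2d; reflexivity).
assert (Ez : f z = (re2 f (Re z) (Im z), im2 f (Re z) (Im z))) by apply uhp_2d'.
split.
- destruct (is_derive_Cinv (fun t => re2 f t (Im z)) (fun t => im2 f t (Im z)) _ _ _ N f1 f2) as [k1 k2].
  apply (is_dx_of _ z F G); trivial; rewrite Ez; destruct a; assumption.
- destruct (is_derive_Cinv (fun t => re2 f (Re z) t) (fun t => im2 f (Re z) t) _ _ _ N f3 f4) as [k1 k2].
  replace (Ci * - (a / (f z * f z)))%C with (- (Ci * a / (f z * f z)))%C
    by (unfold Cdiv; ring).
  apply (is_dy_of _ z F G); trivial; rewrite Ez; destruct (Ci * a)%C; assumption.
Qed.

(** The value of the derivative is left unspecified: it cancels when the operator [d_dx + i d_dy] is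
    applied. *)
Lemma is_hol_Cpowz h z a k : (forall z, h z <> RtoC 0) -> is_hol h z a ->
  exists b, is_hol (fun z => Cpowz (h z) k) z b.
Proof.
intros hn ha.
assert (P : forall n, exists b, is_hol (fun z => Cpow (h z) n) z b).
{ induction n as [|n [b hb]]; [exists (RtoC 0); exact (is_hol_const (RtoC 1) z)|].
  eexists; exact (is_hol_mult _ _ _ _ _ ha hb). }
destruct k as [|p|p]; simpl.
- exists (RtoC 0); exact (is_hol_const (RtoC 1) z).
- apply P.
- destruct (P (Pos.to_nat p)) as [b hb]; eexists; apply is_hol_inv; [|exact hb].
  intros w; apply Cpow_nz, hn.
Qed.

(** * Integer powers and the automorphy factor *)

Lemma Cpowz_nz w k : w <> RtoC 0 -> Cpowz w k <> RtoC 0.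
Proof.
intros hw; destruct k; simpl.
- intros h; apply RtoC_inj in h; lra.
- apply Cpow_nz, hw.
- intros h; apply (f_equal (fun t => (t * w ^ Pos.to_nat p)%C)) in h.
  rewrite Cinv_l, Cmult_0_l in h by (apply Cpow_nz, hw); apply RtoC_inj in h; lra.
Qed.

Lemma Cpowz_succ w k : w <> RtoC 0 -> Cpowz w (Z.succ k) = (w * Cpowz w k)%C.
Proof.
intros hw; destruct k as [|p|p].
- simpl; ring.
- replace (Z.succ (Z.pos p)) with (Z.pos (Pos.succ p)) by lia; simpl.
  rewrite Pos2Nat.inj_succ, Cpow_S; reflexivity.
- destruct (Pos.succ_pred_or p) as [-> | <-]; [simpl; field; exact hw|].
  replace (Z.succ (Z.neg (Pos.succ (Pos.pred p)))) with (Z.neg (Pos.pred p)) by lia; simpl.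
  rewrite Pos2Nat.inj_succ, Cpow_S; field; split; trivial; apply Cpow_nz; trivial.
Qed.

Lemma Cpowz_opp w k : w <> RtoC 0 -> Cpowz w (- k) = (/ Cpowz w k)%C.
Proof.
intros hw; destruct k; simpl; [|reflexivity|].
- field; intros h; apply RtoC_inj in h; lra.
- field; apply Cpow_nz, hw.
Qed.

Lemma Cpowz_conj w k : w <> RtoC 0 -> Cconj (Cpowz w k) = Cpowz (Cconj w) k.
Proof.
intros hw; destruct k; simpl.
- apply C_ext; unfold Re, Im; simpl; ring.
- apply Cpow_conj.
- rewrite Cinv_conj by (apply Cpow_nz, hw); rewrite Cpow_conj; reflexivity.
Qed.

Lemma Cpowz_mult v w k : v <> RtoC 0 -> w <> RtoC 0 ->
  Cpowz (v * w) k = (Cpowz v k * Cpowz w k)%C.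
Proof.
intros hv hw; destruct k; simpl; [ring | apply Cpow_mult_l|].
rewrite Cpow_mult_l; field; split; apply Cpow_nz; trivial.
Qed.

Lemma Cpowz_1_l k : Cpowz (RtoC 1) k = RtoC 1.
Proof.
destruct k; simpl; rewrite ?Cpow_1_l; [reflexivity | reflexivity |].
field; intros h; apply RtoC_inj in h; lra.
Qed.

Lemma Cpowz_real r k : 0 < r -> Cpowz (RtoC r) k = RtoC (powerRZ r k).
Proof.
intros hr; destruct k; simpl; [reflexivity | symmetry; apply RtoC_pow|].
rewrite RtoC_inv by (apply pow_nonzero; lra); rewrite RtoC_pow; reflexivity.
Qed.

Lemma automorphy_denom_nz g (z : ℍ) : automorphy_denom g z <> RtoC 0.
Proof.
destruct g as [a b c d hdet], z as [[x y] hy]; unfold automorphy_denom; simpl in *; intros h.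
injection h as h1 h2.
assert (hc : IZR c * y = 0) by lra.
apply Rmult_integral in hc; destruct hc as [hc | hc]; [|lra].
assert (hd : IZR d = 0) by (rewrite hc in h1; lra).
apply eq_IZR in hc; apply eq_IZR in hd; subst; lia.
Qed.

Lemma det_C (g : SL2Z) :
  (RtoC (IZR (sl_a g)) * RtoC (IZR (sl_d g)) - RtoC (IZR (sl_b g)) * RtoC (IZR (sl_c g)))%C = RtoC 1.
Proof.
destruct g as [a b c d h]; simpl.
rewrite <- !RtoC_mult, <- RtoC_minus, <- !mult_IZR, <- minus_IZR, h; reflexivity.
Qed.

Lemma is_hol_automorphy_denom g z :
  is_hol (fun z => automorphy_denom g z) z (RtoC (IZR (sl_c g))).
Proof.
replace (RtoC (IZR (sl_c g)))
  with (RtoC 0 * uhp_val z + RtoC (IZR (sl_c g)) * RtoC 1 + RtoC 0)%C by ring.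
apply (is_hol_plus _ (fun _ => RtoC (IZR (sl_d g)))); [|apply is_hol_const].
apply (is_hol_mult (fun _ => RtoC (IZR (sl_c g)))); [apply is_hol_const | apply is_hol_id].
Qed.

Lemma is_hol_mobius g z : is_hol (fun z => uhp_val (mobius g z)) z
  (/ (automorphy_denom g z * automorphy_denom g z))%C.
Proof.
assert (hn := automorphy_denom_nz g z).
set (N := fun z : ℍ => (RtoC (IZR (sl_a g)) * uhp_val z + RtoC (IZR (sl_b g)))%C).
assert (HN : is_hol N z (RtoC 0 * uhp_val z + RtoC (IZR (sl_a g)) * RtoC 1 + RtoC 0)%C).
{ apply (is_hol_plus _ (fun _ => RtoC (IZR (sl_b g)))); [|apply is_hol_const].
  apply (is_hol_mult (fun _ => RtoC (IZR (sl_a g)))); [apply is_hol_const | apply is_hol_id]. }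
assert (HD := is_hol_inv _ _ _ (automorphy_denom_nz g) (is_hol_automorphy_denom g z)).
assert (H := is_hol_mult _ _ _ _ _ HN HD); cbv beta in H.
match type of H with is_hol _ _ ?v =>
  replace (/ (automorphy_denom g z * automorphy_denom g z))%C with v; [exact H|] end.
transitivity ((RtoC (IZR (sl_a g)) * RtoC (IZR (sl_d g)) - RtoC (IZR (sl_b g)) * RtoC (IZR (sl_c g)))
  / (automorphy_denom g z * automorphy_denom g z))%C.
- unfold N; unfold automorphy_denom in *; field; exact hn.
- rewrite det_C; field; exact hn.
Qed.

Lemma Im_mobius g (z : ℍ) : RtoC (Im (mobius g z)) =
  (RtoC (Im z) * / (automorphy_denom g z * Cconj (automorphy_denom g z)))%C.
Proof.
assert (hn := automorphy_denom_nz g z).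
assert (hc : Cconj (automorphy_denom g z) <> RtoC 0).
{ intros h; apply hn; rewrite <- (Cconj_conj (automorphy_denom g z)), h.
  apply C_ext; unfold Re, Im; simpl; ring. }
assert (h2 : (RtoC 2 * Ci)%C <> RtoC 0) by (intros h; injection h as h3 h4; lra).
rewrite !im_alt; unfold mobius; cbn [uhp_val]; unfold mobius_val.
rewrite Cdiv_conj by exact hn.
unfold automorphy_denom in *; rewrite !Cplus_conj, !Cmult_conj in *.
assert (R : forall r, Cconj (RtoC r) = RtoC r)
  by (intros; apply C_ext; unfold Re, Im; simpl; ring).
(* The imaginary part is [(z - conj z) / 2i]. The factor 1 is inserted on the right as [ad - bc],
   which is what the numerator on the left produces. *)
rewrite !R in *; rewrite <- (Cmult_1_l ((uhp_val z - Cconj z) / _)), <- (det_C g).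
field; repeat split; trivial; intros h; apply h2; rewrite h; ring.
Qed.

(** Apply [d_dx + i d_dy] to the functional equation. On the left the chain rule yields the
    conjugate of the Möbius derivative [1/j^2]; on the right the holomorphic factor [j^k] passes
    through. *)
Lemma modular_dzbar f k g z : smooth f -> modular k f ->
  (d_dx f (mobius g z) + Ci * d_dy f (mobius g z))%C =
  (Cconj (automorphy_denom g z * automorphy_denom g z) * Cpowz (automorphy_denom g z) k
   * (d_dx f z + Ci * d_dy f z))%C.
Proof.
intros hf hm.
assert (hn := automorphy_denom_nz g z).
destruct (is_hol_mobius g z) as [m1 m2].
destruct (is_hol_Cpowz _ z _ k (automorphy_denom_nz g) (is_hol_automorphy_denom g z)) as (b & b1 & b2).
assert (E : (fun z => f (mobius g z)) = (fun z => (Cpowz (automorphy_denom g z) k * f z)%C))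
  by (extensionality w; apply hm).
assert (X := is_dx_comp f (mobius g) z _ hf m1).
assert (Y := is_dy_comp f (mobius g) z _ hf m2).
rewrite E in X, Y.
assert (X2 := is_dx_mult _ _ _ _ _ b1 (is_dx_smooth f z hf)).
assert (Y2 := is_dy_mult _ _ _ _ _ b2 (is_dy_smooth f z hf)).
apply is_dx_unique in X; apply is_dy_unique in Y.
rewrite (is_dx_unique _ _ _ X2) in X; rewrite (is_dy_unique _ _ _ Y2) in Y.
set (j := automorphy_denom g z) in *; set (J := (j * j)%C) in *.
assert (hJ : J <> RtoC 0) by (apply Cmult_neq_0; trivial).
set (a := (/ J)%C) in *.
assert (H : (Cconj a * (d_dx f (mobius g z) + Ci * d_dy f (mobius g z)))%C
  = (Cpowz j k * (d_dx f z + Ci * d_dy f z))%C).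
{ transitivity ((d_dx f (mobius g z) * RtoC (Re a) + d_dy f (mobius g z) * RtoC (Im a))
   + Ci * (d_dx f (mobius g z) * RtoC (Re (Ci * a)) + d_dy f (mobius g z) * RtoC (Im (Ci * a))))%C.
  - destruct a; apply C_ext; unfold Re, Im; simpl; ring.
  - rewrite <- X, <- Y.
    replace (b * f z + Cpowz j k * d_dx f z + Ci * (Ci * b * f z + Cpowz j k * d_dy f z))%C
      with ((1 + Ci * Ci) * (b * f z) + Cpowz j k * (d_dx f z + Ci * d_dy f z))%C by ring.
    (* The unknown derivative [b] of [j^k] occurs only with the factor [1 + i^2]. *)
    replace (1 + Ci * Ci)%C with (RtoC 0); [ring|].
    apply C_ext; unfold Re, Im; simpl; ring. }
rewrite <- Cmult_assoc, <- H; unfold a; rewrite Cinv_conj by exact hJ.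
field; intros h; apply hJ; rewrite <- (Cconj_conj J), h; apply C_ext; unfold Re, Im; simpl; ring.
Qed.

(** Powers of [j] are counted: [Im(gz)^k] contributes [j^(-k) conj(j)^(-k)], and the conjugated
    factor of [modular_dzbar] contributes [j^2 conj(j)^k]. The product is [j^(2-k)]. *)
Lemma modular_xi f k : smooth f -> modular k f -> modular (2 - k) (xi k f).
Proof.
intros hf hm g z; rewrite !xi_eq, (modular_dzbar f k g z hf hm).
assert (hn := automorphy_denom_nz g z); set (j := automorphy_denom g z) in *.
assert (hc : Cconj j <> RtoC 0).
{ intros h; apply hn; rewrite <- (Cconj_conj j), h; apply C_ext; unfold Re, Im; simpl; ring. }
assert (hy : RtoC (Im z) <> RtoC 0)
  by (intros h; apply RtoC_inj in h; pose proof (uhp_pos z); lra).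
unfold ypow; rewrite <- (Cpowz_real _ _ (uhp_pos z)), <- (Cpowz_real _ _ (uhp_pos (mobius g z))).
rewrite Im_mobius; fold j.
assert (hi : forall w, w <> RtoC 0 -> (/ w)%C <> RtoC 0).
{ intros w hw h; apply (f_equal (fun t => (t * w)%C)) in h.
  rewrite Cinv_l, Cmult_0_l in h by exact hw; apply RtoC_inj in h; lra. }
assert (P1 := Cpowz_nz j k hn); assert (P2 := Cpowz_nz (Cconj j) k hc).
replace (Cpowz j (2 - k)) with (j * j * / Cpowz j k)%C.
2:{ replace (2 - k)%Z with (Z.succ (Z.succ (- k))) by lia.
    rewrite !Cpowz_succ, Cpowz_opp by exact hn; ring. }
replace (/ (j * Cconj j))%C with (/ j * / Cconj j)%C by (field; split; trivial).
rewrite !Cpowz_mult by (repeat apply Cmult_neq_0; auto).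
assert (I : forall w, w <> RtoC 0 -> Cpowz (/ w) k = (/ Cpowz w k)%C).
{ intros w hw.
  assert (T : (Cpowz (/ w) k * Cpowz w k)%C = RtoC 1).
  { rewrite <- Cpowz_mult, Cinv_l by auto.
    apply Cpowz_1_l. }
  rewrite <- (Cmult_1_r (Cpowz (/ w) k)), <- (Cinv_r (Cpowz w k)), Cmult_assoc, T
    by (apply Cpowz_nz, hw); ring. }
rewrite !I by trivial; rewrite !Cmult_conj, Cconj_conj, Cpowz_conj by exact hn.
field; split; trivial.
Qed.

(** * The spaces V *)

Lemma periodic_of_modular k f : modular k f -> periodic f.
Proof.
intros hm x y h; specialize (hm (MkSL2Z 1 1 0 1 eq_refl) (UHP (x, y) h)).
replace (UHP (x + 1, y) h) with (mobius (MkSL2Z 1 1 0 1 eq_refl) (UHP (x, y) h)).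
- rewrite hm; unfold automorphy_denom; simpl.
  replace (RtoC 0 * (x, y) + RtoC 1)%C with (RtoC 1) by ring; rewrite Cpowz_1_l; ring.
- apply uhp_eq; cbn [mobius uhp_val]; unfold mobius_val, automorphy_denom; simpl.
  replace (RtoC 0 * (x, y) + RtoC 1)%C with (RtoC 1) by ring.
  apply C_ext; unfold Re, Im; simpl; field.
Qed.

(** The logarithms of [y] and [y0] differ by at most [ln 2]; the absolute value of [alpha] covers
    both signs of the exponent. *)
Lemma Rpower_le_of_ratio (y y0 alpha : R) : 0 < y -> y <= 2 * y0 -> y0 <= 2 * y ->
  Rpower y alpha <= Rpower 2 (Rabs alpha) * Rpower y0 alpha.
Proof.
intros hy h1 h2; unfold Rpower; rewrite <- exp_plus.
assert (l1 : ln y <= ln 2 + ln y0) by (rewrite <- ln_mult by lra; apply ln_le; lra).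
assert (l2 : ln y0 <= ln 2 + ln y) by (rewrite <- ln_mult by lra; apply ln_le; lra).
assert (H : alpha * (ln y - ln y0) <= Rabs alpha * ln 2).
{ eapply Rle_trans; [apply Rle_abs|]; rewrite Rabs_mult.
  apply Rmult_le_compat_l; [apply Rabs_pos | apply Rabs_le; lra]. }
assert (L : alpha * ln y <= Rabs alpha * ln 2 + alpha * ln y0) by lra.
destruct L as [L | L]; [left; apply exp_increasing, L | right; f_equal; exact L].
Qed.

Lemma V_periodic_solution k m l f : V k m l f -> periodic_solution k l m f.
Proof.
intros (hf & hm & hi & _); split; [exact hf|]; split; [eapply periodic_of_modular; eassumption|].
extensionality z; apply hi.
Qed.

Lemma moderate_growth_xi k m l f : V k m l f -> moderate_growth (xi k f).
Proof.
intros hV; assert (hs := V_periodic_solution _ _ _ _ hV).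
destruct hV as (hf & _ & _ & (alpha & B & Y & hB)).
destruct (gradient_bound k l m) as (G & hG & H).
(* [c y^alpha] dominates [|f|] on the whole window of heights around [y], where heights differ from
   [y] by a factor of at most 2. The threshold [Y + 1] used below keeps that window above [Y]. *)
set (c := Rabs B * Rpower 2 (Rabs alpha)).
assert (hP : forall x a, 0 < Rpower x a) by (intros; apply exp_pos).
assert (hc : 0 <= c)
  by (apply Rmult_le_pos; [apply Rabs_pos | left; apply hP]).
exists (IZR k + alpha), (2 * (G * c)), (Rmax 2 (Y + 1)).
intros [[x y] h] hy; cbn [Im uhp_val snd] in hy |- *.
change (Im (x, y)) with y in *.
assert (h2 := Rle_trans _ _ _ (Rmax_l _ _) hy); assert (hY := Rle_trans _ _ _ (Rmax_r _ _) hy).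
assert (hS : 0 <= c * Rpower y alpha) by (apply Rmult_le_pos; [trivial | left; apply hP]).
destruct (H x y h f (c * Rpower y alpha) h2 hs hS) as [Hx Hy].
{ intros z [_ [z1 z2]].
  assert (zY : Y <= Im z) by lra.
  eapply Rle_trans; [apply (hB z zY)|].
  eapply Rle_trans; [apply Rmult_le_compat_r; [left; apply hP | apply Rle_abs]|].
  unfold c; rewrite Rmult_assoc; apply Rmult_le_compat_l; [apply Rabs_pos|].
  apply Rpower_le_of_ratio; lra. }
rewrite xi_eq; set (z := UHP (x, y) h) in *.
rewrite !Cmod_mult, Cmod_Ci, Cmod_conj; unfold ypow; change (Im z) with y.
rewrite Cmod_R, powerRZ_Rpower, Rabs_pos_eq by (trivial; left; apply hP).
assert (T : Cmod (d_dx f z + Ci * d_dy f z) <= 2 * (G * (c * Rpower y alpha))).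
{ eapply Rle_trans; [apply Cmod_triangle|]; rewrite Cmod_mult, Cmod_Ci; lra. }
rewrite Rpower_plus, Rmult_1_l.
apply (Rmult_le_compat_l _ _ _ (Rlt_le _ _ (hP y (IZR k)))) in T; lra.
Qed.

Lemma xi_maps_into k m l : maps_into (V k m l) (V (2 - k) m (Cconj l)) (xi k).
Proof.
intros f hV; assert (hg := moderate_growth_xi _ _ _ _ hV).
destruct (V_periodic_solution _ _ _ _ hV) as (hf & _ & hi).
split; [apply smooth_xi, hf|]; split; [apply modular_xi; [exact hf | apply hV]|].
split; [|exact hg].
intros z; rewrite <- xi_iter, hi, xi_zero by exact hf; reflexivity.
Qed.

(** * Vector space structure of [V] *)

Lemma moderate_growth_plus f g : moderate_growth f -> moderate_growth g ->
  moderate_growth (fun z => (f z + g z)%C).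
Proof.
intros (a1 & B1 & Y1 & H1) (a2 & B2 & Y2 & H2).
(* Heights at least 1 make [Rpower] monotone in the exponent, and absolute values allow for negative
   [B1] or [B2]. *)
exists (Rmax a1 a2), (Rabs B1 + Rabs B2), (Rmax 1 (Rmax Y1 Y2)).
intros z hz.
assert (z1 := Rle_trans _ _ _ (Rmax_l _ _) hz); assert (z2 := Rle_trans _ _ _ (Rmax_r _ _) hz).
specialize (H1 z (Rle_trans _ _ _ (Rmax_l _ _) z2)); specialize (H2 z (Rle_trans _ _ _ (Rmax_r _ _) z2)).
assert (P : forall a, 0 < Rpower (Im z) a) by (intros; apply exp_pos).
assert (M : forall B a, a <= Rmax a1 a2 ->
  B * Rpower (Im z) a <= Rabs B * Rpower (Im z) (Rmax a1 a2)).
{ intros B a ha; eapply Rle_trans; [apply Rmult_le_compat_r; [left; apply P | apply Rle_abs]|].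
  apply Rmult_le_compat_l; [apply Rabs_pos | apply Rle_Rpower; trivial]. }
assert (M1 := M B1 a1 (Rmax_l _ _)); assert (M2 := M B2 a2 (Rmax_r _ _)).
eapply Rle_trans; [apply Cmod_triangle | lra].
Qed.

Lemma moderate_growth_scal c f : moderate_growth f -> moderate_growth (fun z => (c * f z)%C).
Proof.
intros (a & B & Y & H); exists a, (Cmod c * B), Y; intros z hz.
rewrite Cmod_mult, Rmult_assoc; apply Rmult_le_compat_l; [apply Cmod_ge_0 | apply H, hz].
Qed.

Lemma V_plus k m l f g : V k m l f -> V k m l g -> V k m l (fun z => (f z + g z)%C).
Proof.
intros (f1 & f2 & f3 & f4) (g1 & g2 & g3 & g4); split; [apply smooth_plus; trivial|].
split; [intros s z; rewrite f2, g2; ring|].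
split; [|apply moderate_growth_plus; trivial].
intros z; rewrite iter_plus, f3, g3 by trivial; ring.
Qed.

Lemma V_scal k m l c f : V k m l f -> V k m l (fun z => (c * f z)%C).
Proof.
intros (f1 & f2 & f3 & f4); split; [apply smooth_mult; trivial; apply smooth_const|].
split; [intros s z; rewrite f2; ring|].
split; [|apply moderate_growth_scal; trivial].
intros z; rewrite iter_scal, f3 by trivial; ring.
Qed.

Lemma iter_zero k l m : Nat.iter m (Laplacian_minus k l) (fun _ => RtoC 0) = fun _ => RtoC 0.
Proof.
replace (fun _ : ℍ => RtoC 0) with (fun _ : ℍ => (RtoC 0 * RtoC 0)%C) at 1
  by (extensionality z; ring).
rewrite (iter_scal k l m _ (fun _ => RtoC 0)) by apply smooth_const.
extensionality z; ring.
Qed.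

Lemma V_zero k m l : V k m l (fun _ => RtoC 0).
Proof.
split; [apply smooth_const|]; split; [intros s z; ring|]; split; [intros z; rewrite iter_zero; reflexivity|].
exists 0, 0, 0; intros z _; rewrite Cmod_0; lra.
Qed.

Lemma V_subspace k m l : subspace (V k m l).
Proof.
split; [apply V_zero|]; split; [intros; apply V_plus; trivial | intros; apply V_scal; trivial].
Qed.

(** Growth of the Laplacian would ask for bounds on second derivatives; they come for free by
    factoring it as two operators [xi], each preserving growth. *)
Lemma V_Laplacian k m l f : V k m l f -> V k m l (Laplacian k f).
Proof.
intros hV; rewrite <- xi_xi by apply hV.
assert (H := xi_maps_into _ _ _ _ (xi_maps_into _ _ _ _ hV)).
rewrite Cconj_conj in H; replace (2 - (2 - k))%Z with k in H by lia; exact H.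
Qed.

Lemma V_S k m l f : V k m l f -> V k (S m) l f.
Proof.
intros hV; destruct (V_periodic_solution _ _ _ _ hV) as (_ & _ & hi).
destruct hV as (f1 & f2 & _ & f4); split; [trivial|]; split; [trivial|]; split; [|trivial].
intros z; rewrite Nat.iter_succ, hi.
exact (f_equal (fun h => h z) (iter_zero k l 1)).
Qed.

(** * Inverting the Laplacian on [V] *)

Lemma Laplacian_minus_eq k l f :
  Laplacian_minus k l f = fun z => (Laplacian k f z + (- l) * f z)%C.
Proof. extensionality z; unfold Laplacian_minus; ring. Qed.

(* If [D g' = (D - l) h] then [h = D ((h - g') / l)], which drives the induction on [m]. *)
Lemma Laplacian_surjective k m l : l <> RtoC 0 -> forall h, V k m l h ->
  exists g, V k m l g /\ Laplacian k g = h.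
Proof.
intros hl; induction m as [|m IH]; intros h hV.
- exists (fun _ => RtoC 0); split; [apply V_zero|].
  destruct hV as (_ & _ & hi & _); simpl in hi; extensionality z; rewrite hi.
  assert (E := f_equal (fun f => f z) (iter_zero k l 1)).
  transitivity (Laplacian k (fun _ => RtoC 0) z - l * RtoC 0)%C; [ring | exact E].
(* One factor of the annihilating power has been applied already, so [m] factors are left for the
   image of [h]. *)
- assert (h1 : V k m l (Laplacian_minus k l h)).
  { assert (W : V k (S m) l (Laplacian_minus k l h)).
    { rewrite Laplacian_minus_eq; apply V_plus; [apply V_Laplacian | apply V_scal]; trivial. }
    destruct W as (w1 & w2 & _ & w4); split; [trivial|]; split; [trivial|]; split; [|trivial].
    intros z; rewrite <- Nat.iter_succ_r; apply hV. }
  destruct (IH _ h1) as (g & gV & E).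
  exists (fun z => (/ l * (h z + (- RtoC 1) * g z))%C); split.
  { apply V_scal, V_plus; [trivial|]; apply V_scal, V_S; trivial. }
  assert (sh : smooth h) by apply hV; assert (sg : smooth g) by apply gV.
  rewrite Laplacian_scal, Laplacian_plus, Laplacian_scal, E by smooth.
  extensionality z; unfold Laplacian_minus; field; exact hl.
Qed.

(** On the kernel of the Laplacian, [Laplacian_minus] is multiplication by [-l], so its vanishing
    [m]-th power reads [(-l)^m h = 0]. *)
Lemma V_eq_zero_of_Laplacian k m l h : l <> RtoC 0 -> V k m l h ->
  Laplacian k h = (fun _ => RtoC 0) -> h = fun _ => RtoC 0.
Proof.
intros hl (sh & _ & hi & _) E; revert hi; induction m as [|m IH]; intros hi.
- extensionality z; apply hi.
- apply IH; intros z; specialize (hi z); rewrite Nat.iter_succ_r in hi.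
  replace (Laplacian_minus k l h) with (fun z => (- l * h z)%C) in hi
    by (extensionality w; unfold Laplacian_minus; rewrite E; ring).
  rewrite iter_scal in hi by exact sh.
  replace (Nat.iter m (Laplacian_minus k l) h z)
    with (- / l * (- l * Nat.iter m (Laplacian_minus k l) h z))%C by (field; exact hl).
  rewrite hi; ring.
Qed.

Theorem theorem1p3 (k : Z) (m : nat) (lambda : C)
    (hk : Z.Even k) (hm : (1 <= m)%nat) :
  maps_into (V k m lambda) (V (2 - k)%Z m (Cconj lambda)) (xi k) /\
  (lambda <> RtoC 0 ->
   conj_linear_iso (V k m lambda) (V (2 - k)%Z m (Cconj lambda)) (xi k)).
Proof.
split; [apply xi_maps_into|]; intros hl.
assert (hl' : Cconj lambda <> RtoC 0).
{ intros h; apply hl; rewrite <- (Cconj_conj lambda), h; apply C_ext; unfold Re, Im; simpl; ring. }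
split; [apply V_subspace|]; split; [apply V_subspace|]; split; [|split; [|split]].
- split; [intros f g hf hg; apply xi_plus; [apply hf | apply hg]|].
  intros c f hf; apply xi_scal, hf.
- apply xi_maps_into.
- intros f g hf hg E.
  (* The difference of [f] and [g] is killed by [xi k], hence by [Laplacian k]. *)
  set (h := fun z => (f z + (- RtoC 1) * g z)%C).
  assert (hV : V k m lambda h) by (apply V_plus; [trivial | apply V_scal; trivial]).
  assert (Z0 : h = fun _ => RtoC 0).
  { apply (V_eq_zero_of_Laplacian k m lambda); trivial.
    assert (sf : smooth f) by apply hf; assert (sg : smooth g) by apply hg.
    rewrite <- xi_xi by apply hV.
    replace (xi k h) with (fun _ : ℍ => RtoC 0); [apply xi_zero|].
    unfold h; rewrite xi_plus, xi_scal, E by smooth.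
    extensionality z; apply C_ext; unfold Re, Im; simpl; ring. }
  extensionality z; assert (E2 := f_equal (fun u => u z) Z0); unfold h in E2; cbv beta in E2.
  replace (f z) with (f z + - RtoC 1 * g z + g z)%C by ring; rewrite E2; ring.
(* Writing [h] as [Laplacian (2 - k) g], which is [xi k (xi (2 - k) g)], exhibits [xi (2 - k) g] as
   a preimage. *)
- intros h hh; destruct (Laplacian_surjective (2 - k) m _ hl' h hh) as (g & gV & E).
  exists (xi (2 - k) g); split.
  + assert (H := xi_maps_into _ _ _ _ gV).
    rewrite Cconj_conj in H; replace (2 - (2 - k))%Z with k in H by lia; exact H.
  + rewrite <- E, <- (xi_xi (2 - k) g) by apply gV.
    replace (2 - (2 - k))%Z with k by lia; reflexivity.
Qed.
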